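(* Let $\mathcal{B}$ denote the class of planar compact sets whose boundary consists of a finite number of closed disjoint simple polygonal curves (each one with finitely many edges). If $A\in\mathcal{B}$ and $g_A=g_K$ for some convex body $K$ in $\mathbb{R}^2$, then $A$ is convex.
   Context: For a compact set $A\subset\mathbb{R}^n$, the covariogram $g_A:\mathbb{R}^n\to\mathbb{R}$ is defined by $g_A(x)=\lambda_n(A\cap(A+x))$, where $\lambda_n$ is $n$-dimensional Lebesgue measure and $A+x=\{a+x:a\in A\}$; here $n=2$. A convex body in $\mathbb{R}^n$ is a convex compact set with non-empty interior.
   Formalization: The sets in the class are also required to be the closure of their interior; otherwise a convex polygon together with a disjoint polygonal curve surrounding it is a non-convex member with the same covariogram as the polygon. *)

(* Defs.v *)
From mathcomp Require Import all_boot all_order all_algebra.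
From mathcomp Require Import all_classical all_reals all_analysis.

Set Implicit Arguments.
Unset Strict Implicit.
Unset Printing Implicit Defensive.

Import Order.TTheory GRing.Theory Num.Theory.
Import numFieldNormedType.Exports.

Local Open Scope classical_set_scope.
Local Open Scope ring_scope.

(* R^o * R^o carries both the (sup-norm, hence Euclidean) topology of the plane
   and its structure of vector space over R. *)
Notation plane R := (R^o * R^o)%type.

(* The product sigma-algebra is the Borel one of the plane, so the product
   measure is the planar Lebesgue measure on compact sets. *)
Definition lambda2 {R : realType} :
    set (measurableTypeR R * measurableTypeR R) -> \bar R :=
  (@lebesgue_measure R \x @lebesgue_measure R)%E.

Definition translate {R : realType} (A : set (plane R)) (x : plane R) :
    set (plane R) :=
  [set a + x | a in A].

(* Meaningful for compact A, for which the measure is finite. *)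
Definition covariogram {R : realType} (A : set (plane R)) (x : plane R) : R :=
  fine (lambda2 (A `&` translate A x)).

Definition convex_body {R : realType} (K : set (plane R)) : Prop :=
  [/\ convex_set K, compact K & K° !=set0].

Definition boundary {T : topologicalType} (A : set T) : set T :=
  closure A `\` A°.

(* The closed polygonal curve with cyclic list of vertices p; its i-th edge goes
   from p i to the cyclic successor and is parametrized by t in [0, 1[, so that
   the curve is traversed exactly once when (i, t) ranges over 'I_n x [0, 1[. *)
Definition polygonal_path {R : realType} (n : nat) (p : 'I_n -> plane R)
    (u : 'I_n * R) : plane R :=
  (1 - u.2) *: p u.1 + u.2 *: p (ordS u.1).

(* Simplicity is injectivity of the cyclic parametrization (which forces at
   least three vertices). *)
Definition simple_closed_polygonal_curve {R : realType} (C : set (plane R)) :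
    Prop :=
  exists (n : nat) (p : 'I_n.+1 -> plane R),
    set_inj (setT `*` `[0, 1[) (polygonal_path p) /\
    C = polygonal_path p @` (setT `*` `[0, 1[).

(* Regularity (A is the closure of its interior) makes explicit that the curves
   bound A: it excludes exactly the boundary curves near which A has no interior
   point. Otherwise a convex polygon together with a disjoint closed polygonal
   curve surrounding it would be a nonconvex member of the class with the same
   covariogram as the convex polygon. *)
Definition classB {R : realType} (A : set (plane R)) : Prop :=
  [/\ compact A, regclosed A &
    exists (k : nat) (C : 'I_k -> set (plane R)),
      [/\ forall i, simple_closed_polygonal_curve (C i),
          trivIset setT C &
          boundary A = \bigcup_i C i]].

(* Main.v *)
(* Let w = (0, 1).  Slicing both sets by vertical lines, the limit of
   (2 g(z) - g(z + e w) - g(z - e w)) / e as e tends to 0 is the integral over x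
   of the kink of z at x: the sum, over the common boundary points of the slice
   of A above x and of the slice of A + z above x, of the products of the jumps
   of the two indicator functions.  Hence g determines these integrals.

   Take z = t (1, a) with t small.  For A, only the boundary lines of slope a
   contribute, and passing from 2 t to t increases the integral by at least t
   for each such line carrying a part of the boundary.  For a convex body, the
   increase is at most t for each of the two supporting lines of slope a that
   touches the body in a nondegenerate segment.  As A - A = K - K, if one of these
   two faces of K is nondegenerate then so is one of those of A, and if both
   are then, comparing the integrals at a z carrying one face of K onto the
   other, so are both those of A.  So a boundary line of A that does not support
   A would be one line too many.

   Exchanging the coordinates handles the vertical lines.  Finally, a set all of
   whose boundary lines are supporting has no boundary point on a segment
   joining two of its interior points. *)
Require Import Defs.
From mathcomp Require Import all_boot all_order all_algebra.
From mathcomp Require Import all_classical all_reals all_analysis.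
From mathcomp Require Import measurable_realfun.
From mathcomp Require Import ring lra.

Set Implicit Arguments.
Unset Strict Implicit.
Unset Printing Implicit Defensive.

Import Order.TTheory GRing.Theory Num.Theory.
Import numFieldNormedType.Exports.

Local Open Scope classical_set_scope.
Local Open Scope ring_scope.

(** * Preliminaries *)

(** The comparison of t with 2 t turns lengths into a count. Let j(x) be the jump along one line of
    slope a, a step function with values in {-1, 0, 1}. For small t the integral of j(x) j(x - t) is
    that of j^2 minus t / 2 times the sum of the squared changes of j. Subtracting the value at 2 t
    cancels the unknown total length; what remains is at least t as soon as j is not zero, since j
    then changes at least twice. The proof bounds the integrand j(x) (j(x - t) - j(x - 2 t))
    pointwise instead of computing this sum.

    [K] is not assumed polygonal, so its bound cannot come from a list of lines. It rests on a
    property of convex functions: away from the minimum there is at most one horizontal chord of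
    length t. Both kinds of sets are covered by [sliced], and everything is compared off finite sets
    of abscissas.

    Only jumps along vertical slices enter the kink, so vertical boundary lines are invisible to it.
    This is why the last step fills a box first vertically and then, for the transposed set,
    horizontally. *)

Lemma nbhs_plane (R : realType) (u : plane R) (A : set (plane R)) :
  nbhs u A <-> exists2 e : R, 0 < e &
    forall x y, `|x - u.1| < e -> `|y - u.2| < e -> A (x, y).
Proof.
split=> [/nbhs_ballP[e /= e0 eA]|[e e0 eA]].
  by exists e => // x y xu yu; apply: eA; split; rewrite /ball/= distrC.
apply/nbhs_ballP; exists e => // -[x y] [/= xu yu].
by apply: eA; rewrite distrC.
Qed.

Lemma continuous_translation (R : realType) (z : plane R) :
  continuous (fun a : plane R => a + z).
Proof.
move=> u A /nbhs_plane[e e0 eA]; apply/nbhs_plane; exists e => // x y xu yu.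
apply: (eA (x + z.1) (y + z.2)); by rewrite [X in _ - X]/= opprD addrACA subrr addr0.
Qed.

Lemma seq_gap (R : realType) (B : seq R) (b : R) :
  exists2 d : R, 0 < d & forall b', b' \in B -> b' != b -> d <= `|b' - b|.
Proof.
elim: B => [|c B [d d0 IH]]; first by exists 1.
have [->|cb] := eqVneq c b.
  by exists d => // b'; rewrite inE => /predU1P[->|/IH//]; rewrite eqxx.
exists (Num.min d `|c - b|); first by rewrite lt_min d0 normr_gt0 subr_eq0.
move=> b'; rewrite inE ge_min => /predU1P[-> _|/IH bB /bB ->//].
by rewrite lexx orbT.
Qed.

Lemma seq_separated (R : realType) (B : seq R) :
  exists2 d : R, 0 < d &
    forall b b', b \in B -> b' \in B -> b != b' -> d <= `|b - b'|.
Proof.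
elim: B => [|c B [d d0 IH]]; first by exists 1.
have [e e0 He] := seq_gap B c.
exists (Num.min d e); first by rewrite lt_min d0 e0.
move=> b b'; rewrite !inE ge_min => /predU1P[->|bB] /predU1P[->|b'B].
- by rewrite eqxx.
- by rewrite eq_sym => /(He _ b'B); rewrite distrC => ->; rewrite orbT.
- by move=> /(He _ bB) ->; rewrite orbT.
- by move=> /(IH _ _ bB b'B) ->.
Qed.

(** * Subsets of the line with finitely many breakpoints, and their jumps *)

(** Nothing is required at the points of [B] themselves: [S] may have isolated or missing points
    there, and these carry no jump. *)
Definition stepset (R : realType) (S : set R) (B : seq R) :=
  forall y y', y <= y' -> (forall b, b \in B -> ~~ (y <= b <= y')) -> S y = S y'.

Definition rside (R : realType) (S : set R) (b : R) :=
  exists2 d, 0 < d & forall e, 0 < e < d -> S (b + e).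

Definition lside (R : realType) (S : set R) (b : R) :=
  exists2 d, 0 < d & forall e, 0 < e < d -> S (b - e).

(** One-sided germs are used so that membership of [b] itself does not matter. *)
Definition jump (R : realType) (S : set R) (b : R) : R :=
  (`[<rside S b>])%:R - (`[<lside S b>])%:R.

Lemma stepset_rside (R : realType) (S : set R) B (b e : R) : stepset S B ->
  0 < e -> (forall b', b' \in B -> ~~ (b < b' <= b + e)) ->
  S (b + e) <-> rside S b.
Proof.
move=> SB e0 Be.
have Seq f : 0 < f <= e -> S (b + f) = S (b + e).
  move=> fe; apply: SB => [|b' b'B]; first by lra.
  by apply: contra (Be _ b'B) => h; lra.
split=> [Sbe|[d d0 Sd]].
  by exists e => // f fe; rewrite Seq//; lra.
pose m := Num.min (d / 2) e.
have [m0 md me] : [/\ 0 < m, m < d & m <= e].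
  by rewrite /m; split; rewrite ?lt_min ?gt_min ?ge_min; lra.
by rewrite -(Seq m) ?m0//; apply: Sd; rewrite m0.
Qed.

Lemma stepset_lside (R : realType) (S : set R) B (b e : R) : stepset S B ->
  0 < e -> (forall b', b' \in B -> ~~ (b - e <= b' < b)) ->
  S (b - e) <-> lside S b.
Proof.
move=> SB e0 Be.
have Seq f : 0 < f <= e -> S (b - f) = S (b - e).
  move=> fe; apply/esym; apply: SB => [|b' b'B]; first by lra.
  by apply: contra (Be _ b'B) => h; lra.
split=> [Sbe|[d d0 Sd]].
  by exists e => // f fe; rewrite Seq//; lra.
pose m := Num.min (d / 2) e.
have [m0 md me] : [/\ 0 < m, m < d & m <= e].
  by rewrite /m; split; rewrite ?lt_min ?gt_min ?ge_min; lra.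
by rewrite -(Seq m) ?m0//; apply: Sd; rewrite m0.
Qed.

Lemma stepset_sides (R : realType) (S : set R) B (b : R) : stepset S B ->
  exists2 d, 0 < d & forall e, 0 < e < d ->
    (S (b + e) <-> rside S b) /\ (S (b - e) <-> lside S b).
Proof.
move=> SB; have [d d0 Bd] := seq_gap B b.
exists d => // e ed; split.
- apply: (stepset_rside SB) => [|b' b'B]; first by lra.
  apply/negP => h; have /(Bd _ b'B) : b' != b by apply/eqP; lra.
  by rewrite ger0_norm; lra.
- apply: (stepset_lside SB) => [|b' b'B]; first by lra.
  apply/negP => h; have /(Bd _ b'B) : b' != b by apply/eqP; lra.
  by rewrite ler0_norm; lra.
Qed.

Lemma jump0 (R : realType) (S : set R) B (b : R) :
  stepset S B -> b \notin B -> jump S b = 0.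
Proof.
move=> SB bB; have [d d0 Bd] := seq_gap B b.
suff -> : jump S b = (`[<S (b + d / 2)>])%:R - (`[<S (b - d / 2)>])%:R.
  rewrite (_ : S (b - d / 2) = S (b + d / 2)) ?subrr//.
  apply: SB => [|b' b'B]; first by lra.
  apply/negP => h; have /(Bd _ b'B) : b' != b.
    by apply: contraNneq bB => <-.
  by rewrite ler_normr; lra.
rewrite /jump; congr (_%:R - _%:R); congr nat_of_bool; apply: asbool_equiv_eq; apply: iff_sym.
- apply: (stepset_rside SB) => [|b' b'B]; first by lra.
  apply/negP => h; have /(Bd _ b'B) : b' != b by apply/eqP; lra.
  by rewrite ger0_norm; lra.
- apply: (stepset_lside SB) => [|b' b'B]; first by lra.
  apply/negP => h; have /(Bd _ b'B) : b' != b by apply/eqP; lra.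
  by rewrite ler0_norm; lra.
Qed.

Lemma jump_cases (R : realType) (S : set R) (b : R) :
  [\/ jump S b = 0, jump S b = 1 | jump S b = -1].
Proof.
rewrite /jump; case: `[< _ >]; case: `[< _ >] => /=; rewrite ?subrr ?subr0 ?sub0r.
- by constructor 1.
- by constructor 2.
- by constructor 3.
- by constructor 1.
Qed.

Lemma stepsetS (R : realType) (S : set R) (B B' : seq R) :
  {subset B <= B'} -> stepset S B -> stepset S B'.
Proof. by move=> BB' SB y y' yy' h; apply: SB => // b /BB'; exact: h. Qed.

Lemma stepset_shift (R : realType) (S : set R) (B : seq R) (c : R) :
  stepset S B -> stepset [set y | S (y - c)] [seq b + c | b <- B].
Proof.
move=> SB y y' yy' h /=; apply: SB => [|b bB]; first by lra.
by have := h _ (map_f (fun b => b + c) bB); apply: contra => ?; lra.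
Qed.

Lemma jump_shift (R : realType) (S : set R) (b c : R) :
  jump [set y | S (y - c)] b = jump S (b - c).
Proof.
rewrite /jump; congr (_%:R - _%:R); congr nat_of_bool; apply: asbool_equiv_eq;
  split=> -[d d0 Sd]; exists d => // e /Sd /=.
- by rewrite addrAC.
- by rewrite addrAC.
- by rewrite addrAC.
- by rewrite addrAC.
Qed.

(** The second difference of a correlation is the correlation of the first differences; hence this
    function. *)
Definition fdiff (R : realType) (S : set R) (e y : R) : R :=
  \1_S (y + e) - \1_S y.

Lemma fdiff0 (R : realType) (S : set R) B (e y : R) : stepset S B -> 0 <= e ->
  (forall b, b \in B -> ~~ (y <= b <= y + e)) -> fdiff S e y = 0.
Proof.
move=> SB e0 Be; rewrite /fdiff !indicE.
suff -> : (y + e \in S) = (y \in S) by rewrite subrr.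
have SE : S y = S (y + e) by apply: SB => //; lra.
by apply/idP/idP; rewrite !inE SE.
Qed.

Lemma fdiff_norm (R : realType) (S : set R) (e y : R) : `|fdiff S e y| <= 1.
Proof.
by rewrite /fdiff !indicE; do 2 case: (_ \in _);
  rewrite ?subrr ?subr0 ?sub0r ?normrN ?normr1 ?normr0.
Qed.

Lemma fdiff_jump (R : realType) (S : set R) B (b e y : R) : stepset S B ->
  (forall b', b' \in B -> b' != b -> e < `|b' - b|) -> b - e < y < b ->
  fdiff S e y = jump S b.
Proof.
move=> SB Be yb; rewrite /fdiff /jump !indicE; congr (_%:R - _%:R);
  congr nat_of_bool; rewrite /in_mem/=; apply: asbool_equiv_eq.
- rewrite (_ : y + e = b + (y + e - b)); last by lra.
  apply: (stepset_rside SB) => [|b' b'B]; first by lra.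
  apply/negP => h; have /(Be _ b'B) : b' != b by apply/eqP; lra.
  by rewrite ger0_norm; lra.
- rewrite [X in S X](_ : y = b - (b - y)); last by lra.
  apply: (stepset_lside SB) => [|b' b'B]; first by lra.
  apply/negP => h; have /(Be _ b'B) : b' != b by apply/eqP; lra.
  by rewrite ler0_norm; lra.
Qed.

(** The breakpoints are more than [e] apart, so the intervals []b - e, b[] are disjoint and at most
    one term is nonzero. Their endpoints are excluded because membership of a breakpoint is
    arbitrary. *)
Lemma fdiff_mul_sum (R : realType) (S S' : set R) (B : seq R) (e y : R) :
  uniq B -> stepset S B -> stepset S' B -> 0 < e ->
  (forall b b', b \in B -> b' \in B -> b != b' -> e < `|b - b'|) ->
  (forall b, b \in B -> y != b /\ y != b - e) ->
  fdiff S e y * fdiff S' e y =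
    \sum_(b <- B) jump S b * jump S' b * \1_`]b - e, b[%classic y.
Proof.
move=> uB SB S'B e0 Be yB.
have [[b bB yb]|nb] := pselect (exists2 b, b \in B & b - e < y < b).
  rewrite (bigD1_seq b)//= big_seq_cond big1 ?addr0 => [|b' /andP[b'B b'b]].
    rewrite indicE mem_set ?mulr1; last by rewrite /= in_itv.
    by rewrite !(@fdiff_jump _ _ B b)// => b' b'B; exact: Be.
  rewrite indicE memNset ?mulr0//= in_itv/= => yb'.
  have := Be _ _ b'B bB b'b; rewrite lter_normr; lra.
rewrite (fdiff0 SB) ?mul0r ?ltW//; last first.
  move=> b bB; apply/negP => h; apply: nb; exists b => //.
  by have [/eqP ? /eqP ?] := yB _ bB; lra.
rewrite big_seq big1// => b bB; rewrite indicE memNset ?mulr0//= in_itv/= => h.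
by apply: nb; exists b.
Qed.

(** Valid for every [y] and every step, with no separation of the breakpoints: it provides the
    domination when [e] tends to 0. *)
Lemma fdiff_mul_bound (R : realType) (S S' : set R) (B : seq R) (e y : R) :
  stepset S B -> 0 <= e ->
  `|fdiff S e y * fdiff S' e y| <= \sum_(b <- B) \1_`[b - e, b]%classic y.
Proof.
move=> SB e0.
have [[b bB yb]|nb] := pselect (exists2 b, b \in B & b - e <= y <= b).
  have le1 : `|fdiff S e y * fdiff S' e y| <= 1.
    by rewrite normrM mulr_ile1 ?fdiff_norm.
  rewrite (le_trans le1)// (big_rem b)//= indicE mem_set/=; last by rewrite in_itv.
  by rewrite lerDl sumr_ge0.
rewrite (fdiff0 SB) ?mul0r ?normr0 ?sumr_ge0// => b bB.
by apply/negP => h; apply: nb; exists b => //; lra.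
Qed.

(** * Second difference of a one-dimensional covariogram *)

Lemma integrable_indic_lty (d : measure_display) (T : measurableType d)
    (R : realType) (mu : {measure set T -> \bar R}) (A : set T) :
  measurable A -> (mu A < +oo)%E -> mu.-integrable setT (EFin \o \1_A).
Proof.
move=> mA Aoo; apply/integrableP; split.
  by apply/measurable_EFinP; exact: measurable_indic.
under eq_integral do rewrite /= ger0_norm ?ler0n//.
by rewrite integral_indic// setIT.
Qed.

Lemma Rintegral_indic (d : measure_display) (T : measurableType d)
    (R : realType) (mu : {measure set T -> \bar R}) (A : set T) :
  measurable A -> \int[mu]_x (\1_A x : R) = fine (mu A).
Proof. by move=> mA; rewrite /Rintegral integral_indic// setIT. Qed.

Lemma integrable_sumR (d : measure_display) (T : measurableType d)
    (R : realType) (mu : {measure set T -> \bar R}) (I : Type) (s : seq I)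
    (f : I -> T -> R) :
  (forall i, mu.-integrable setT (EFin \o f i)) ->
  mu.-integrable setT (EFin \o (fun x => \sum_(i <- s) f i x)).
Proof.
move=> fi; have := @integrable_sum _ _ _ mu _ measurableT I s xpredT _ (fun i _ => fi i).
by apply: eq_integrable => // x _ /=; rewrite sumEFin.
Qed.

Lemma Rintegral_sum (d : measure_display) (T : measurableType d)
    (R : realType) (mu : {measure set T -> \bar R}) (I : Type) (s : seq I)
    (f : I -> T -> R) :
  (forall i, mu.-integrable setT (EFin \o f i)) ->
  \int[mu]_x (\sum_(i <- s) f i x) = \sum_(i <- s) \int[mu]_x f i x.
Proof.
move=> fi; elim: s => [|i s IH].
  by rewrite big_nil; under eq_Rintegral do rewrite big_nil; rewrite Rintegral_cst ?mul0r.
rewrite big_cons -IH -RintegralD//; last exact: integrable_sumR.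
by apply: eq_Rintegral => x _; rewrite big_cons.
Qed.

Lemma Rintegral_finite_eq (R : realType) (N : seq R) (f g : R -> R) :
  (forall x, x \notin N -> f x = g x) ->
  measurable_fun setT (f : measurableTypeR R -> measurableTypeR R) ->
  measurable_fun setT (g : measurableTypeR R -> measurableTypeR R) ->
  \int[@lebesgue_measure R]_x f x = \int[@lebesgue_measure R]_x g x.
Proof.
move=> fg mf mg; congr fine; apply: ae_eq_integral => //.
- exact/measurable_EFinP.
- exact/measurable_EFinP.
- exists [set` N]; split.
  + apply: countable_measurable; first by move=> t; exact: measurable_set1.
    exact: finite_set_countable (finite_seq N).
  + exact: (countable_lebesgue_measure0 (finite_set_countable (finite_seq N))).
  + by move=> x /= h; apply: contrapT => /negP xN; apply: h => _; rewrite fg.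
Qed.

Lemma le_Rintegral_finite (R : realType) (N : seq R) (f g : R -> R) :
  (forall x, x \notin N -> f x <= g x) ->
  (@lebesgue_measure R).-integrable setT (EFin \o f) ->
  (@lebesgue_measure R).-integrable setT (EFin \o g) ->
  \int[@lebesgue_measure R]_x f x <= \int[@lebesgue_measure R]_x g x.
Proof.
move=> fg fi gi.
rewrite -subr_ge0 -RintegralB// [X in _ <= X](_ : _ = \int[@lebesgue_measure R]_x `|g x - f x|).
  by apply: Rintegral_ge0.
have mgf : measurable_fun setT ((g \- f) : measurableTypeR R -> measurableTypeR R).
  by apply: measurable_funB; apply/measurable_EFinP; exact: (measurable_int (@lebesgue_measure R)).
apply: (Rintegral_finite_eq (N := N)) => [x /fg ?||].
- by rewrite ger0_norm// subr_ge0.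
- exact: mgf.
- exact: measurableT_comp mgf.
Qed.

(** The image measure under the shift agrees with Lebesgue measure on half-open intervals, which
    characterize it. *)
Lemma lebesgue_measure_shift (R : realType) (S : set R) (c : R) :
  measurable (S : set (measurableTypeR R)) ->
  measurable ([set y | S (y - c)] : set (measurableTypeR R)) /\
  (@lebesgue_measure R) [set y | S (y - c)] = lebesgue_measure S.
Proof.
move=> mS.
pose f : measurableTypeR R -> measurableTypeR R := fun y => y - c.
have mf : measurable_fun setT f.
  exact: measurable_funB.
split; first by rewrite -[X in measurable X]setTI; exact: mf.
rewrite -[LHS]/(pushforward lebesgue_measure f S); apply/esym.
apply: (@lebesgue_measure_unique R (pushforward lebesgue_measure f)) => //=.

move=> _ [[a b]] _ <-.
rewrite /pushforward [X in _ = lebesgue_measure X](_ : _ = `]a + c, b + c]%classic); last first.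
  by apply/seteqP; split=> y /=; rewrite /f !in_itv/=; lra.
rewrite !lebesgue_measure_itv/= !lte_fin ltrD2r; case: ifP => // _.
by rewrite -!EFinB; congr EFin; ring.
Qed.

(* Second difference at [0] of the cross covariogram of two sets of reals. *)
Definition covdiff2 (R : realType) (S S' : set R) (e : R) : R :=
  2 * fine (lebesgue_measure (S `&` S'))
  - fine (lebesgue_measure (S `&` [set y | S' (y - e)]))
  - fine (lebesgue_measure (S `&` [set y | S' (y + e)])).

(** The product of the two first differences expands into four indicators. By translation invariance
    the first, [X1], has the same measure as [X4], which explains the factor 2, and [X2] has that of
    the intersection of [S] with the shift of [S'] by [e]. *)
Lemma covdiff2E (R : realType) (S S' : set R) (e : R) :
  measurable (S : set (measurableTypeR R)) ->
  measurable (S' : set (measurableTypeR R)) ->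
  (lebesgue_measure S < +oo)%E ->
  (@lebesgue_measure R).-integrable setT
    (EFin \o (fun y => fdiff S e y * fdiff S' e y)) /\
  covdiff2 S S' e = \int[@lebesgue_measure R]_y (fdiff S e y * fdiff S' e y).
Proof.
move=> mS mS' Soo.
have shm (X : set R) c : measurable (X : set (measurableTypeR R)) ->
    measurable ([set y | X (y + c)] : set (measurableTypeR R)) /\
    (@lebesgue_measure R) [set y | X (y + c)] = lebesgue_measure X.
  move=> mX; have := lebesgue_measure_shift (- c) mX.
  by under eq_set do rewrite opprK.
pose X1 := [set y | (S `&` S') (y + e)].
pose X2 := [set y | (S `&` [set y | S' (y - e)]) (y + e)].
pose X3 := S `&` [set y | S' (y + e)].
pose X4 := S `&` S'.
have [mS'1 _] := lebesgue_measure_shift e mS'.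
have [mS'2 _] := shm _ e mS'.
have mX4 : measurable (X4 : set (measurableTypeR R)) by exact: measurableI.
have mX3 : measurable (X3 : set (measurableTypeR R)) by exact: measurableI.
have mSS : measurable (S `&` [set y | S' (y - e)] : set (measurableTypeR R)).
  exact: measurableI.
have [mX1 X1E] : measurable (X1 : set (measurableTypeR R)) /\
    @lebesgue_measure R X1 = lebesgue_measure X4 by exact: shm.
have [mX2 X2E] : measurable (X2 : set (measurableTypeR R)) /\
    @lebesgue_measure R X2 = lebesgue_measure (S `&` [set y | S' (y - e)]).
  exact: shm.
have fin (Y : set R) : measurable (S `&` Y : set (measurableTypeR R)) ->
    (@lebesgue_measure R (S `&` Y) < +oo)%E.
  by move=> mY; apply: le_lt_trans Soo; apply: le_measure; rewrite ?inE//; exact: subIsetl.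
have i4 := integrable_indic_lty mX4 (fin _ mX4).
have i3 := integrable_indic_lty mX3 (fin _ mX3).
have i1 : (@lebesgue_measure R).-integrable setT (EFin \o \1_X1).
  have X1oo : (@lebesgue_measure R X1 < +oo)%E by rewrite X1E; exact: fin.
  exact: integrable_indic_lty X1oo.
have i2 : (@lebesgue_measure R).-integrable setT (EFin \o \1_X2).
  have X2oo : (@lebesgue_measure R X2 < +oo)%E by rewrite X2E; exact: fin.
  exact: integrable_indic_lty X2oo.
have DE : (fun y => fdiff S e y * fdiff S' e y) =
    (fun y => \1_X1 y - \1_X2 y - \1_X3 y + \1_X4 y).
  apply/funext => y; rewrite /fdiff.
  have -> : \1_X1 y = \1_S (y + e) * \1_S' (y + e) :> R.
    by rewrite /X1 !indicE -natrM mulnb; congr (nat_of_bool _)%:R; apply/idP/andP; rewrite !inE.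
  have -> : \1_X2 y = \1_S (y + e) * \1_S' y :> R.
    rewrite /X2 !indicE -natrM mulnb; congr (nat_of_bool _)%:R.
    by apply/idP/andP; rewrite !inE /= addrK.
  have -> : \1_X3 y = \1_S y * \1_S' (y + e) :> R.
    by rewrite /X3 !indicE -natrM mulnb; congr (nat_of_bool _)%:R; apply/idP/andP; rewrite !inE.
  have -> : \1_X4 y = \1_S y * \1_S' y :> R by rewrite /X4 indicI.
  ring.
have i12 : (@lebesgue_measure R).-integrable setT (EFin \o (fun y => \1_X1 y - \1_X2 y)).
  exact: (integrableB measurableT i1 i2).
have i123 : (@lebesgue_measure R).-integrable setT
    (EFin \o (fun y => \1_X1 y - \1_X2 y - \1_X3 y)).
  exact: (integrableB measurableT i12 i3).
rewrite DE; split; first exact: (integrableD measurableT i123 i4).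
have I1 : \int[@lebesgue_measure R]_y (\1_X1 y : R) = fine (lebesgue_measure (S `&` S')).
  by rewrite Rintegral_indic//; congr fine; exact: X1E.
have I2 : \int[@lebesgue_measure R]_y (\1_X2 y : R) =
    fine (lebesgue_measure (S `&` [set y | S' (y - e)])).
  by rewrite Rintegral_indic//; congr fine; exact: X2E.
rewrite RintegralD// RintegralB// RintegralB// I1 I2 !Rintegral_indic//.
rewrite /covdiff2 /X3 /X4; ring.
Qed.

Lemma covdiff2_step (R : realType) (S S' : set R) (B : seq R) (e : R) :
  measurable (S : set (measurableTypeR R)) ->
  measurable (S' : set (measurableTypeR R)) ->
  (lebesgue_measure S < +oo)%E ->
  uniq B -> stepset S B -> stepset S' B -> 0 < e ->
  (forall b b', b \in B -> b' \in B -> b != b' -> e < `|b - b'|) ->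
  covdiff2 S S' e = e * \sum_(b <- B) jump S b * jump S' b.
Proof.
move=> mS mS' Soo uB SB S'B e0 Be.
have [iD ->] := covdiff2E e mS mS' Soo.
pose g b y := jump S b * jump S' b * \1_`]b - e, b[%classic y.
have ig b : (@lebesgue_measure R).-integrable setT (EFin \o g b).
  have := integrable_indic_itv (b - e) b false true.
  by move=> /(integrableZl measurableT (jump S b * jump S' b)).
transitivity (\int[@lebesgue_measure R]_y \sum_(b <- B) g b y).
  apply: (Rintegral_finite_eq (N := B ++ [seq b - e | b <- B])).
  - move=> y; rewrite mem_cat negb_or => /andP[yB yBe].
    apply: fdiff_mul_sum => // b bB; split.
      by apply: contraNneq yB => ->.
    by apply: contraNneq yBe => ->; exact: map_f.
  - by apply/measurable_EFinP; exact: (measurable_int (@lebesgue_measure R)).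
  - apply/measurable_EFinP; apply: (measurable_int (@lebesgue_measure R)).
    exact: integrable_sumR.
rewrite Rintegral_sum// mulr_sumr; apply: eq_bigr => b _.
rewrite RintegralZl//; last exact: (integrable_indic_itv (b - e) b false true).
rewrite Rintegral_indic//= lebesgue_measure_itv/= lte_fin ltrBlDr ltrDl e0/=.
by rewrite mulrC; congr (_ * _); lra.
Qed.

Lemma covdiff2_bound (R : realType) (S S' : set R) (B : seq R) (e : R) :
  measurable (S : set (measurableTypeR R)) ->
  measurable (S' : set (measurableTypeR R)) ->
  (lebesgue_measure S < +oo)%E -> stepset S B -> 0 <= e ->
  `|covdiff2 S S' e| <= (size B)%:R * e.
Proof.
move=> mS mS' Soo SB e0.
have [iD ->] := covdiff2E e mS mS' Soo.
have ig (b : R) : (@lebesgue_measure R).-integrable setT (EFin \o \1_`[b - e, b]%classic).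
  exact: (integrable_indic_itv (b - e) b true false).
apply: le_trans (le_normr_Rintegral measurableT iD) _.
have -> : (size B)%:R * e = \int[@lebesgue_measure R]_y \sum_(b <- B) \1_`[b - e, b]%classic y.
  rewrite Rintegral_sum// -sum1_size natr_sum mulr_suml.
  apply: eq_bigr => b _; rewrite Rintegral_indic//= lebesgue_measure_itv/=.
  rewrite lte_fin ltrBlDr; case: ifPn => [_|]; rewrite /= mul1r; first by ring.
  by rewrite ltrDl -leNgt => e0'; apply/eqP; rewrite eq_le e0 e0'.
apply: le_Rintegral => //.
- exact: (integrable_abse iD).
- exact: integrable_sumR.
- by move=> y _; exact: fdiff_mul_bound.
Qed.

(** * Slices and the kink formula *)

Definition slice (R : realType) (A : set (plane R)) (x : R) : set R :=
  [set y | A (x, y)].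

(** An open set is a countable union of rational boxes; this links the topology of the plane with
    the product sigma-algebra. *)
Lemma open_measurable2 (R : realType) (A : set (plane R)) : open A ->
  measurable (A : set (measurableTypeR R * measurableTypeR R)).
Proof.
move=> oA.
pose F (i : (rat * rat) * (rat * rat)) : set (plane R) :=
  `]ratr i.1.1, ratr i.1.2[ `*` `]ratr i.2.1, ratr i.2.2[.
pose G i := if `[<F i `<=` A>] then F i else set0.
suff -> : A = \bigcup_i G i.
  apply: countable_bigcupT_measurable => [//|i].
  rewrite /G; case: ifP => _ //.
  apply: measurableX; exact: measurable_itv.
apply/seteqP; split=> [[x y] Axy|[x y] [i _]]; last first.
  by rewrite /G; case: ifP => // /asboolP; apply.
have /nbhs_ballP[e /= e0 eA] : nbhs ((x, y) : plane R) A by exact: open_nbhs_nbhs.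
have [a /andP[a1 a2]] := @rat_in_itvoo R (x - e) x ltac:(lra).
have [b /andP[b1 b2]] := @rat_in_itvoo R x (x + e) ltac:(lra).
have [c /andP[c1 c2]] := @rat_in_itvoo R (y - e) y ltac:(lra).
have [d /andP[d1 d2]] := @rat_in_itvoo R y (y + e) ltac:(lra).
rewrite !bnd_simp in a1 a2 b1 b2 c1 c2 d1 d2.
exists ((a, b), (c, d)) => //; rewrite /G asboolT.
  by rewrite /F; split; rewrite /= in_itv/=; lra.
move=> [u v] [/=]; rewrite !in_itv/= => hu hv; apply: eA; split => /=;
  by rewrite /ball/= ltr_norml; lra.
Qed.

Lemma compact_measurable2 (R : realType) (A : set (plane R)) : compact A ->
  measurable (A : set (measurableTypeR R * measurableTypeR R)).
Proof.
move=> cA; have : closed A by exact: compact_closed.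
rewrite -openC => /open_measurable2/measurableC; rewrite setCK; exact.
Qed.

Lemma compact_box (R : realType) (A : set (plane R)) : compact A ->
  exists2 L : R, 0 < L & forall x y : R, A (x, y) -> `|x| <= L /\ `|y| <= L.
Proof.
move=> /compact_bounded[N [_ NA]].
exists (`|N| + 1) => [|x y Axy]; first by rewrite ltr_pwDr.
have : `|((x, y) : plane R)| <= `|N| + 1 by apply: NA => //; rewrite ltr_pwDr// ler_norm.
by rewrite prod_normE/= ge_max => /andP[].
Qed.

(** Length above [x] of the intersection of [A] with its translate by [z]. *)
Definition cov_section (R : realType) (A : set (plane R)) (z : plane R) (x : R) : R :=
  fine (lebesgue_measure (slice A x `&` [set y | slice A (x - z.1) (y - z.2)])).

Lemma translateE (R : realType) (A : set (plane R)) (z : plane R) :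
  translate A z = [set u | A (u - z)].
Proof.
apply/seteqP; split=> [_ [a Aa <-]|u Au]; first by rewrite /= addrK.
by exists (u - z); rewrite // subrK.
Qed.

Lemma slice_measurable (R : realType) (A : set (plane R)) (x : R) : compact A ->
  measurable (slice A x : set (measurableTypeR R)) /\
  (lebesgue_measure (slice A x) < +oo)%E.
Proof.
move=> cA; have mS : measurable (slice A x : set (measurableTypeR R)).
  rewrite (_ : slice A x = xsection A x).
    by apply: measurable_xsection; exact: compact_measurable2.
  by apply/seteqP; split=> y; rewrite /xsection/= inE.
split=> //; have [L L0 AL] := compact_box cA.
apply: (@le_lt_trans _ _ (lebesgue_measure `[- L, L]%classic)).
  apply: le_measure; rewrite ?inE//.
  by move=> y /AL[_]; rewrite /= in_itv/= ler_norml.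
by rewrite lebesgue_measure_itv/=; case: ifP => _; rewrite ?ltry.
Qed.

(** The product measure is the integral of the lengths of the vertical sections; a bounding square
    of [A] gives integrability. *)
Lemma covariogram_sections (R : realType) (A : set (plane R)) (z : plane R) :
  compact A ->
  (@lebesgue_measure R).-integrable setT (EFin \o cov_section A z) /\
  covariogram A z = \int[@lebesgue_measure R]_x cov_section A z x.
Proof.
move=> cA.
pose S : set (measurableTypeR R * measurableTypeR R) := A `&` translate A z.
have mS : measurable S.
  apply: measurableI; first exact: compact_measurable2.
  have cA' : compact (translate A z).
    apply: (continuous_compact _ cA); apply: continuous_subspaceT.
    exact: continuous_translation.
  exact: compact_measurable2.
have SE x : xsection S x = slice A x `&` [set y | slice A (x - z.1) (y - z.2)].
  by rewrite /S translateE; apply/seteqP; split=> y; rewrite /xsection/= inE.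
have fS x : (lebesgue_measure (xsection S x) < +oo)%E.
  have [mA Aoo] := slice_measurable x cA.
  apply: le_lt_trans Aoo; apply: le_measure; rewrite ?inE//.
    exact: measurable_xsection.
  by rewrite SE; exact: subIsetl.
have EE : EFin \o cov_section A z = lebesgue_measure \o xsection S.
  apply/funext => x /=; rewrite /cov_section -SE fineK// ge0_fin_numE//.
have [L L0 AL] := compact_box cA.
split; last by rewrite /covariogram /Rintegral -/(EFin \o cov_section A z) EE.
apply: (@le_integrable _ _ _ lebesgue_measure setT measurableT (EFin \o cov_section A z)
  (EFin \o (fun x => (2 * L) * \1_`[- L, L]%classic x))).
- by rewrite EE; exact: measurable_fun_xsection.
- move=> x _; rewrite [X in `|X|%E](_ : _ = lebesgue_measure (xsection S x)); last first.
    by rewrite -[RHS]/((lebesgue_measure \o xsection S) x) -EE.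
  rewrite gee0_abs//= indicE.
  have [xL|xL] := boolP (x \in `[- L, L]%classic); last first.
    rewrite (_ : xsection S x = set0) ?measure0 ?lee_fin ?normr_ge0//.
    rewrite SE; apply/seteqP; split=> y //= -[/AL[+ _] _].
    rewrite ler_norml => xL'; move/negP: xL; apply.
    by rewrite inE/= in_itv.
  have -> : `|2 * L * (nat_of_bool true)%:R| = L - - L.
    by rewrite mulr1 ger0_norm; lra.
  apply: (@le_trans _ _ (lebesgue_measure `[- L, L]%classic)).
    apply: le_measure; rewrite ?inE//.
    - exact: measurable_xsection.
    - by rewrite SE => y [/AL[_]]; rewrite /= in_itv/= ler_norml.
  by rewrite lebesgue_measure_itv/= lte_fin; case: ifP; rewrite ?lee_fin//; lra.
- have := integrable_indic_itv (- L) L true false.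
  by move=> /(integrableZl measurableT (2 * L)).
Qed.

(* Off the finite set N, the slice above x is a finite union of intervals and
   points with endpoints in B x. *)
Definition sliced (R : realType) (A : set (plane R)) (N : seq R)
    (B : R -> seq R) (M : nat) :=
  compact A /\ forall x, x \notin N ->
    [/\ uniq (B x), (size (B x) <= M)%N & stepset (slice A x) (B x)].

(* The value 0 is a convention on the finite exceptional set. *)
Definition kink (R : realType) (A : set (plane R)) (N : seq R)
    (B : R -> seq R) (z : plane R) (x : R) : R :=
  if (x \in N) || (x - z.1 \in N) then 0 else
  \sum_(b <- B x) jump (slice A x) b * jump (slice A (x - z.1)) (b - z.2).

Definition covariogram_diff2 (R : realType) (A : set (plane R)) (z : plane R) (e : R) : R :=
  2 * covariogram A z - covariogram A (z + (0, e)) - covariogram A (z - (0, e)).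

Lemma big_uniq_sub (R : nmodType) (I : eqType) (B C : seq I) (F : I -> R) :
  uniq B -> uniq C -> {subset B <= C} ->
  (forall c, c \in C -> c \notin B -> F c = 0) ->
  \sum_(b <- B) F b = \sum_(c <- C) F c.
Proof.
move=> uB uC BC F0; rewrite [RHS](bigID (mem B))/= [X in _ + X]big_seq_cond.
rewrite [X in _ + X]big1 ?addr0 => [|c /andP[cC cB]]; last exact: F0.
rewrite -[RHS]big_filter; apply: perm_big; apply: uniq_perm; rewrite ?filter_uniq//.
by move=> b; rewrite mem_filter/=; case: (boolP (b \in B)) => // /BC ->.
Qed.

(** A shift of [z] by [(0, e)] leaves [z.1] alone, so the same two slices are compared and the
    second difference can be taken section by section. *)
Lemma covariogram_diff2_sections (R : realType) (A : set (plane R)) (z : plane R) (e : R) :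
  compact A ->
  let f x := covdiff2 (slice A x) [set y | slice A (x - z.1) (y - z.2)] e in
  (@lebesgue_measure R).-integrable setT (EFin \o f) /\
  covariogram_diff2 A z e = \int[@lebesgue_measure R]_x f x.
Proof.
move=> cA f.
have [i0 E0] := covariogram_sections z cA.
have [i1 E1] := covariogram_sections (z + (0, e)) cA.
have [i2 E2] := covariogram_sections (z - (0, e)) cA.
have fE : f = (fun x => 2 * cov_section A z x - cov_section A (z + (0, e)) x
    - cov_section A (z - (0, e)) x).
  apply/funext => x; rewrite /f /covdiff2 /cov_section /= addr0 subr0.
  have -> : [set y | slice A (x - z.1) (y - e - z.2)] =
      [set y | slice A (x - z.1) (y - (z.2 + e))].
    by apply/funext => y /=; congr (slice _ _ _); ring.
  have -> // : [set y | slice A (x - z.1) (y + e - z.2)] =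
      [set y | slice A (x - z.1) (y - (z.2 - e))].
    by apply/funext => y /=; congr (slice _ _ _); ring.
have i02 : (@lebesgue_measure R).-integrable setT
    (EFin \o (fun x => 2 * cov_section A z x)).
  exact: (integrableZl measurableT 2 i0).
have i01 : (@lebesgue_measure R).-integrable setT
    (EFin \o (fun x => 2 * cov_section A z x - cov_section A (z + (0, e)) x)).
  exact: (integrableB measurableT i02 i1).
rewrite fE; split; first exact: (integrableB measurableT i01 i2).
by rewrite RintegralB// RintegralB// RintegralZl// /covariogram_diff2 E0 E1 E2.
Qed.

(* Off a finite set of abscissas the second difference of each section is
   eventually exactly proportional to the step, which gives the pointwise
   limit used with dominated convergence. *)
Lemma kink_cvg (R : realType) (A : set (plane R)) N B M (z : plane R) :
  sliced A N B M ->
  (@lebesgue_measure R).-integrable setT (EFin \o kink A N B z) /\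
  (fun n => n.+1%:R * covariogram_diff2 A z (n.+1%:R^-1)) @ \oo -->
    \int[@lebesgue_measure R]_x kink A N B z x.
Proof.
move=> [cA AB].
pose e n : R := n.+1%:R^-1.
have e0 n : 0 < e n by rewrite invr_gt0.
pose bad x := (x \in N) || (x - z.1 \in N).
pose N' := N ++ [seq x + z.1 | x <- N].
have badN' x : x \notin N' -> bad x = false.
  rewrite mem_cat negb_or => /andP[xN xN']; apply/negbTE; rewrite negb_or xN/=.
  by apply: contra xN' => /(map_f (fun x => x + z.1)); rewrite subrK.
pose h n x := n.+1%:R * covdiff2 (slice A x) [set y | slice A (x - z.1) (y - z.2)] (e n).
pose f n x := if bad x then 0 else h n x.
have ih n : (@lebesgue_measure R).-integrable setT (EFin \o h n).
  have [i1 _] := covariogram_diff2_sections z (e n) cA.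
  exact: (integrableZl measurableT n.+1%:R i1).
have mh n : measurable_fun setT (h n : measurableTypeR R -> measurableTypeR R).
  by apply/measurable_EFinP; exact: (measurable_int (@lebesgue_measure R)).
have mbad : measurable_fun setT (bad : measurableTypeR R -> bool).
  apply: (measurable_fun_bool true); rewrite setTI.
  apply: countable_measurable; first by move=> t; exact: measurable_set1.
  apply: finite_set_countable; apply: (@sub_finite_set _ _ [set` N']) => [x|//].
  by rewrite /preimage/=; have [//|/badN' ->] := boolP (x \in N').
have mf n : measurable_fun setT (f n : measurableTypeR R -> measurableTypeR R).
  apply: measurable_fun_ifT => //.
have hE n : n.+1%:R * covariogram_diff2 A z (e n) = \int[@lebesgue_measure R]_x f n x.
  have [i1 ->] := covariogram_diff2_sections z (e n) cA.
  rewrite -RintegralZl//; apply: (Rintegral_finite_eq (N := N')) => //.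
  - by move=> x /badN'; rewrite /f => ->.
  - exact: mh.
have fcvg x : (fun n => f n x) @ \oo --> kink A N B z x.
  rewrite /f /kink -/(bad x); case: ifP => [_|/norP[xN xN']]; first exact: cvg_cst.
  have [uB sB SB] := AB x xN.
  have [uB' sB' SB'] := AB _ xN'.
  (* Common breakpoints of both slices. Enlarging [B x] to [C] does not change the sum, as the slice
     above [x] has no jump outside [B x]. *)
  pose C := undup (B x ++ [seq b + z.2 | b <- B (x - z.1)]).
  have SC : stepset (slice A x) C.
    by apply: (stepsetS _ SB) => b bB; rewrite mem_undup mem_cat bB.
  have SC' : stepset [set y | slice A (x - z.1) (y - z.2)] C.
    apply: (stepsetS _ (stepset_shift (c := z.2) SB')) => b bB.
    by rewrite mem_undup mem_cat bB orbT.
  have [d d0 Cd] := seq_separated C.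
  have [mS Soo] := slice_measurable x cA.
  have [mS0 _] := slice_measurable (x - z.1) cA.
  have [mS' _] := lebesgue_measure_shift z.2 mS0.
  have -> : \sum_(b <- B x) jump (slice A x) b * jump (slice A (x - z.1)) (b - z.2) =
      \sum_(b <- C) jump (slice A x) b * jump [set y | slice A (x - z.1) (y - z.2)] b.
    under [RHS]eq_bigr do rewrite jump_shift.
    apply: big_uniq_sub => //; first exact: undup_uniq.
      by move=> b bB; rewrite mem_undup mem_cat bB.
    by move=> c _ cB; rewrite (jump0 SB cB) mul0r.
  apply: cvg_near_cst; apply: filterS (near_infty_natSinv_lt (PosNum d0)) => m md; rewrite /= in md.
  rewrite /h (covdiff2_step (B := C))//.
  - by rewrite mulrA mulfV ?mul1r// pnatr_eq0.
  - exact: undup_uniq.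
  - move=> b b' bC b'C bb'; exact: lt_le_trans (Cd _ _ bC b'C bb').
have [L L0 AL] := compact_box cA.
(* The second difference is at most [M] times the step, and the slice of [A] is empty outside
   [[- L, L]]. *)
pose g (x : R) : R := M%:R * \1_`[- L, L]%classic x.
have ig : (@lebesgue_measure R).-integrable setT (EFin \o g).
  have := integrable_indic_itv (- L) L true false.
  by move=> /(integrableZl measurableT M%:R).
have fg n x : `|f n x| <= g x.
  rewrite /f; case: ifP => [_|/norP[xN _]].
    by rewrite normr0 /g mulr_ge0// indicE ler0n.
  have [mS Soo] := slice_measurable x cA.
  have [mS0 _] := slice_measurable (x - z.1) cA.
  have [mS' _] := lebesgue_measure_shift z.2 mS0.
  have [_ sB SB] := AB x xN.
  have [xL|xL] := boolP (x \in `[- L, L]%classic); last first.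
    have S0 : slice A x = set0.
      apply/seteqP; split=> y //= /AL[xL' _]; move/negP: xL; apply.
      by rewrite inE/= in_itv/= -ler_norml.
    rewrite /h /covdiff2 S0 !set0I !measure0/= !subr0 !mulr0 normr0.
    by rewrite /g mulr_ge0// indicE ler0n.
  rewrite /g indicE xL mulr1 /h normrM ger0_norm//.
  have := covdiff2_bound mS mS' Soo SB (ltW (e0 n)).
  rewrite -(ler_pM2l (ltr0Sn R n)) => /le_trans; apply.
  by rewrite /e mulrCA mulfV ?pnatr_eq0// mulr1 ler_nat.
have mF n : measurable_fun setT (EFin \o f n : measurableTypeR R -> \bar R).
  by apply/measurable_EFinP; exact: mf.
have Fcvg x : (fun n => (EFin \o f n) x) @ \oo --> (EFin \o kink A N B z) x.
  by apply: cvg_EFin; [exact: nearW | exact: fcvg].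
have mK : measurable_fun setT (EFin \o kink A N B z : measurableTypeR R -> \bar R).
  by apply: (emeasurable_fun_cvg (fun n => EFin \o f n)) => // x _; exact: Fcvg.
have ae1 : {ae @lebesgue_measure R, forall x, setT x ->
    (fun n => (EFin \o f n) x) @ \oo --> (EFin \o kink A N B z) x}.
  by apply: aeW => x _; exact: Fcvg.
have ae2 : {ae @lebesgue_measure R, forall x n, setT x ->
    (`|(EFin \o f n) x| <= (EFin \o g) x)%E}.
  by apply: aeW => x n _; exact: fg.
have [iK _ cK] := @dominated_convergence _ _ _ (@lebesgue_measure R) setT measurableT
  (fun n => EFin \o f n) (EFin \o kink A N B z) (EFin \o g) mF mK ae1 ig ae2.
split => //.
under eq_fun do rewrite hE.
apply: fine_cvg; rewrite fineK; last exact: integrable_fin_num.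
exact: cK.
Qed.

(** Both integrals are limits of one and the same sequence, which sees the sets only through their
    covariograms. The slicing data may be unrelated: a set bounded by lines can be compared with an
    arbitrary convex body. *)
Lemma kink_integral_eq (R : realType) (A A' : set (plane R)) N B M N' B' M' z :
  sliced A N B M -> sliced A' N' B' M' -> covariogram A =1 covariogram A' ->
  \int[@lebesgue_measure R]_x kink A N B z x =
  \int[@lebesgue_measure R]_x kink A' N' B' z x.
Proof.
move=> sA sA' gAA'.
have [_ c1] := kink_cvg z sA; have [_ c2] := kink_cvg z sA'.
apply: cvg_unique c2; first exact: norm_hausdorff.
by move: c1; rewrite /covariogram_diff2; under eq_fun do rewrite !gAA'.
Qed.

(** * Sets bounded by lines *)

Lemma affine_continuous (R : realType) (u v : plane R) :
  continuous (fun s : R => (u.1 + s * v.1, u.2 + s * v.2) : plane R).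
Proof.
move=> s A /nbhs_plane[e e0 eA]; apply/nbhs_ballP.
pose k := `|v.1 : R| + `|v.2 : R| + 1.
have k0 : 0 < k by rewrite ltr_wpDl// addr_ge0.
exists (e / k); first by rewrite /= divr_gt0.
move=> s'; rewrite /ball/= ltr_pdivlMr// => ss'.
have h (w : R) : `|w| <= k -> `|s' * w - s * w| < e.
  move=> wk; rewrite -mulrBl normrM distrC.
  by apply: le_lt_trans ss'; rewrite ler_wpM2l.
apply: eA => /=; rewrite opprD addrACA subrr add0r; apply: h.
  by rewrite /k -addrA lerDl addr_ge0.
by rewrite /k [_ + `|v.2|]addrC -addrA lerDl addr_ge0.
Qed.

Definition seg (R : realType) (u v : plane R) (s : R) : plane R :=
  (u.1 + s * (v.1 - u.1), u.2 + s * (v.2 - u.2)).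

(** The parameters of the points of [A] form an open and closed subset of [[0, 1]], which is
    connected. *)
Lemma segment_nobd (R : realType) (A : set (plane R)) (u v : plane R) :
  closed A -> (forall s : R, 0 <= s <= 1 -> A (seg u v s) -> A° (seg u v s)) ->
  A u -> A v.
Proof.
move=> cA nb Au.
have cf : continuous (seg u v) := affine_continuous (v := v - u).
have E := @segment_connected R 0 1 (`[0, 1]%classic `&` seg u v @^-1` A).
have : `[0, 1]%classic `&` seg u v @^-1` A = `[0, 1]%classic.
  apply: E.
  - exists 0; split; rewrite /= ?in_itv/= ?lexx ?ler01//.
    by rewrite /seg !mul0r !addr0 -surjective_pairing.
  - exists (seg u v @^-1` A°); first by apply: open_comp => [? _|]; [exact: cf|exact: open_interior].
    apply/seteqP; split=> s [s01 As]; split=> //; first by apply: nb => //; rewrite /= in_itv in s01.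
    exact: interior_subset As.
  - exists (seg u v @^-1` A) => //.
    by apply: closed_comp => // ? _; exact: cf.
move=> /seteqP[_ /(_ 1)] []; first by rewrite /= in_itv/= lexx ler01.
by rewrite /seg/= !mul1r !subrKC -surjective_pairing.
Qed.

Lemma convex_gt0 (R : realType) (s p q : R) : 0 <= s <= 1 -> 0 < p -> 0 < q ->
  0 < (1 - s) * p + s * q.
Proof.
move=> /andP[s0 s1] p0 q0; have [pq|qp] := leP p q.
  have : 0 <= s * (q - p) by rewrite mulr_ge0// subr_ge0.
  lra.
have : 0 <= (1 - s) * (p - q) by rewrite mulr_ge0 ?subr_ge0// ltW.
lra.
Qed.

Section lined.
Variable R : realType.
Implicit Types (A : set (plane R)) (V : seq R) (L : seq (R * R)).

Definition line (l : R * R) (x : R) : R := l.1 * x + l.2.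

(* V lists the abscissas of the vertical boundary lines; a nonvertical line is
   given by its slope and its intercept. *)
Definition lined A V L := [/\ compact A, regclosed A, uniq L &
  forall x y : R, A (x, y) -> ~ A° (x, y) ->
    x \in V \/ exists2 l, l \in L & y = line l x].

(* For parallel lines the quotient is a harmless junk value. *)
Definition breaks V L : seq R :=
  V ++ [seq (p.2.2 - p.1.2) / (p.1.1 - p.2.1) | p <- [seq (l, l') | l <- L, l' <- L]].

Lemma breaks_cross V L (l l' : R * R) (x : R) : l \in L -> l' \in L ->
  l.1 != l'.1 -> line l x = line l' x -> x \in breaks V L.
Proof.
move=> lL l'L ll' E; rewrite mem_cat; apply/orP; right.
apply/mapP; exists (l, l'); first by apply/allpairsP; exists (l, l').
rewrite /=; move: E; rewrite /line => E.
have nz : l.1 - l'.1 != 0 by rewrite subr_eq0.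
by apply: (mulfI nz); rewrite mulrC [RHS]mulrC divfK//; lra.
Qed.

Lemma line_inj V L (l l' : R * R) (x : R) : l \in L -> l' \in L ->
  x \notin breaks V L -> line l x = line l' x -> l = l'.
Proof.
move=> lL l'L xN E; have [e1|ne1] := eqVneq l.1 l'.1; last first.
  by rewrite (breaks_cross V lL l'L ne1 E) in xN.
by move: E; rewrite /line e1 => /addrI; case: l l' e1 {lL l'L} => [? ?] [? ?] /= -> ->.
Qed.

(** Two lines change order only at their crossing, whose abscissa is in [breaks V L]. *)
Lemma line_order V L (l l' : R * R) (x x' : R) : l \in L -> l' \in L ->
  x <= x' -> (forall n, n \in breaks V L -> ~~ (x <= n <= x')) ->
  line l x < line l' x -> line l x' < line l' x'.
Proof.
move=> lL l'L xx' nN lt; rewrite ltNge; apply/negP => ge.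
have ne : l.1 - l'.1 != 0.
  apply/eqP => e; have e1 : l.1 = l'.1 by lra.
  by move: lt ge; rewrite /line e1; lra.
pose c := (l'.2 - l.2) / (l.1 - l'.1).
have Ec : line l c = line l' c.
  rewrite /line; have -> : l.2 = l'.2 - c * (l.1 - l'.1) by rewrite /c divfK//; ring.
  ring.
have cN : c \in breaks V L by apply: (breaks_cross V lL l'L _ Ec); rewrite -subr_eq0.
have := nN _ cN; rewrite negb_and -!ltNge.
move: lt ge Ec; rewrite /line => lt ge Ec.
have h (z : R) : l.1 * z + l.2 - (l'.1 * z + l'.2) = (l.1 - l'.1) * (z - c).
  by rewrite [X in _ = X](_ : _ = (l.1 * z + l.2 - (l'.1 * z + l'.2)) - (l.1 * c + l.2 - (l'.1 * c + l'.2))); [lra|ring].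
have h1 : (l.1 - l'.1) * (x - c) < 0 by rewrite -h; lra.
have h2 : (l.1 - l'.1) * (x' - c) >= 0 by rewrite -h; lra.
by case/orP => hc; nra.
Qed.

(** The segment joining the two points meets no line of [V] or [L], hence no boundary point of [A]:
    [segment_nobd] applies in both directions. *)
Lemma lined_cell A V L (x x' y y' : R) : lined A V L -> x <= x' ->
  (forall n, n \in breaks V L -> ~~ (x <= n <= x')) ->
  (forall l, l \in L -> (line l x < y /\ line l x' < y') \/
                        (y < line l x /\ y' < line l x')) ->
  A (x, y) <-> A (x', y').
Proof.
move=> [cA rA uL AL] xx' nN sd.
have clA : closed A by exact: compact_closed.
have key (s : R) : 0 <= s <= 1 -> A (seg (x, y) (x', y') s) -> A° (seg (x, y) (x', y') s).
  move=> s01 As; apply: contrapT => nA.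
  have [/= sV|[l lL /= E]] := AL _ _ As nA.
    have := nN (x + s * (x' - x)); rewrite mem_cat sV => /(_ isT); rewrite negb_and -!ltNge.
    by case/orP => h; nra.
  have E2 : (1 - s) * (y - line l x) + s * (y' - line l x') = 0.
    have -> : (1 - s) * (y - line l x) + s * (y' - line l x') =
        y + s * (y' - y) - line l (x + s * (x' - x)) by rewrite /line; ring.
    by rewrite E subrr.
  have [[h h']|[h h']] := sd _ lL.
    by have := convex_gt0 s01 (p := y - line l x) (q := y' - line l x'); lra.
  by have := convex_gt0 s01 (p := line l x - y) (q := line l x' - y'); lra.
split; apply: segment_nobd => //.
move=> s s01; have := key (1 - s); rewrite /seg/=.
have -> : x + (1 - s) * (x' - x) = x' + s * (x - x') by ring.
have -> : y + (1 - s) * (y' - y) = y' + s * (y - y') by ring.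
by apply; lra.
Qed.

Definition cuts L (x : R) : seq R := [seq line l x | l <- L].

Lemma lined_sliced A V L : lined A V L -> sliced A (breaks V L) (cuts L) (size L).
Proof.
move=> Al; have [cA rA uL AL] := Al; split=> // x xN; split.
- rewrite map_inj_in_uniq// => l l' lL l'L; exact: line_inj xN.
- by rewrite size_map.
- move=> y y' yy' nb; apply/propext; apply: (lined_cell Al) => //.
    move=> n nN; rewrite -eq_le eq_sym; apply: contraNneq xN => <-//.
  move=> l lL; have := nb _ (map_f (fun l => line l x) lL).
  by rewrite negb_and -!ltNge => /orP[h|h]; [left|right]; split; lra.
Qed.

Definition ljump A (l : R * R) (x : R) : R := jump (slice A x) (line l x).

(** Between consecutive breaks the lines keep their order, so the points just above [l] over [x] and
    over [x'] lie in one cell, and likewise just below. *)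
Lemma ljump_const A V L (l : R * R) (x x' : R) : lined A V L -> l \in L ->
  x <= x' -> (forall n, n \in breaks V L -> ~~ (x <= n <= x')) ->
  ljump A l x = ljump A l x'.
Proof.
move=> Al lL xx' nN.
have xN : x \notin breaks V L by apply/negP => /nN; rewrite lexx xx'.
have xN' : x' \notin breaks V L by apply/negP => /nN; rewrite lexx xx'.
have [_ sA] := lined_sliced Al.
have [_ _ S] := sA _ xN; have [_ _ S'] := sA _ xN'.
have [d d0 dS] := stepset_sides (line l x) S.
have [d' d'0 d'S] := stepset_sides (line l x') S'.
have [g g0 gS] := seq_gap (cuts L x) (line l x).
have [g' g'0 g'S] := seq_gap (cuts L x') (line l x').
(* Small enough to read off both germs and to stay clear of all other lines, at [x] and at [x']. *)
pose e := Num.min (Num.min d d') (Num.min g g') / 2.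
have [e0 [ed ed' eg eg']] : 0 < e /\ [/\ e < d, e < d', e < g & e < g'].
  have m0 : 0 < Num.min (Num.min d d') (Num.min g g') by rewrite !lt_min d0 d'0 g0 g'0.
  have [] : e < Num.min d d' /\ e < Num.min g g'.
    have le1 : Num.min (Num.min d d') (Num.min g g') <= Num.min d d' by rewrite ge_min lexx.
    have le2 : Num.min (Num.min d d') (Num.min g g') <= Num.min g g'.
      by rewrite ge_min lexx orbT.
    rewrite /e; lra.
  by rewrite !lt_min => /andP[-> ->] /andP[-> ->]; split=> //; rewrite /e; lra.
have cell (f : R) : (f = e \/ f = - e) -> A (x, line l x + f) <-> A (x', line l x' + f).
  move=> fe; apply: (lined_cell Al) => // l' l'L.
  have [->|ll'] := eqVneq l' l; first by case: fe => ->; [left|right]; lra.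
  have ne : line l' x != line l x by apply: contra_neq ll' => /(line_inj l'L lL xN).
  have ne' : line l' x' != line l x' by apply: contra_neq ll' => /(line_inj l'L lL xN').
  have := gS _ (map_f (fun l => line l x) l'L) ne.
  have := g'S _ (map_f (fun l => line l x') l'L) ne'.
  move: ne; rewrite neq_lt => /orP[lt|lt].
    have lt' := line_order l'L lL xx' nN lt.
    by rewrite !ltr0_norm ?subr_lt0// => h1 h2; left; case: fe => ->; lra.
  have lt' := line_order lL l'L xx' nN lt.
  by rewrite !gtr0_norm ?subr_gt0// => h1 h2; right; case: fe => ->; lra.
rewrite /ljump /jump.
have [] := dS e; first by rewrite e0.
have [] := d'S e; first by rewrite e0.
have := cell e (or_introl erefl); have := cell (- e) (or_intror erefl); rewrite /slice/=.
move=> c1 c2 r' l' r l''; congr (_%:R - _%:R); congr nat_of_bool; apply: asbool_equiv_eq; tauto.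
Qed.

End lined.

(** * Lower bound: each line carrying boundary contributes at least t *)

Section lined_lower.
Variable R : realType.
Implicit Types (A : set (plane R)) (V : seq R) (L : seq (R * R)).

(** Breaks are more than [2 * t] apart, so at most one lies between [x - 2 * t] and [x]. Either the
    two values in the difference agree, or those at [x] and [x - t] do, and then j^2 - j j' is
    nonnegative for j, j' in {-1, 0, 1}. *)
Lemma ljump_term_ge0 A V L (l : R * R) (t x : R) : lined A V L -> l \in L ->
  0 < t -> (forall n n', n \in breaks V L -> n' \in breaks V L -> n != n' -> 2 * t < `|n - n'|) ->
  x \notin breaks V L -> x - t \notin breaks V L -> x - 2 * t \notin breaks V L ->
  0 <= ljump A l x * (ljump A l (x - t) - ljump A l (x - 2 * t)).
Proof.
move=> Al lL t0 sep x0 x1 x2.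
have [[n nN nx]|nN] := pselect (exists2 n, n \in breaks V L & x - t <= n <= x).
  rewrite (@ljump_const _ A V L l (x - 2 * t) (x - t)) ?subrr ?mulr0//; first by lra.
  move=> n' n'N; apply/negP => n'x.
  have nn' : n != n'.
    apply/eqP => E; have E1 : n = x - t by lra.
    by rewrite -E1 nN in x1.
  by have := sep _ _ nN n'N nn'; rewrite ger0_norm; lra.
rewrite (@ljump_const _ A V L l (x - t) x)//; first last.
- by move=> n nN'; apply/negP => h; apply: nN; exists n.
- lra.
rewrite /ljump; case: (jump_cases (slice A x) (line l x)) => ->;
  case: (jump_cases (slice A (x - 2 * t)) (line l (x - 2 * t))) => ->; lra.
Qed.

Lemma jump_nonempty (S : set R) (b : R) : jump S b != 0 -> exists y, S y.
Proof.
rewrite /jump; case: (boolP `[< rside S b >]) => [/asboolP[d d0 dS] _|_].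
  by exists (b + d / 2); apply: dS; lra.
case: (boolP `[< lside S b >]) => [/asboolP[d d0 dS] _|_]; last by rewrite subrr eqxx.
by exists (b - d / 2); apply: dS; lra.
Qed.

(** Look at the leftmost point of the line carrying a jump: just to its right the jump is a constant
    of absolute value 1, to its left it is 0. *)
Lemma ljump_term_ge1 A V L (l : R * R) (t x0 : R) : lined A V L -> l \in L ->
  0 < t -> (forall n n', n \in breaks V L -> n' \in breaks V L -> n != n' -> 2 * t < `|n - n'|) ->
  x0 \notin breaks V L -> ljump A l x0 != 0 ->
  exists c : R, forall x, c < x < c + t ->
  x \notin breaks V L -> x - t \notin breaks V L -> x - 2 * t \notin breaks V L ->
  1 <= ljump A l x * (ljump A l (x - t) - ljump A l (x - 2 * t)).
Proof.
move=> Al lL t0 sep x0N jx0; have [cA _ _ _] := Al.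
pose E := [set x | x \notin breaks V L /\ ljump A l x != 0].
have [M M0 AM] := compact_box cA.
have Elb : has_inf E.
  split; first by exists x0.
  exists (- M) => x [_ /jump_nonempty[y /AM[+ _]]].
  by rewrite ler_norml => /andP[].
pose c := inf E; have cE x : E x -> c <= x by apply: ge_inf; case: Elb.
have Ec e : 0 < e -> exists2 v, E v & v < c + e.
  by move=> e0; exact: inf_adherent.
(* Otherwise the jump would be the same slightly to the left of [c], against the choice of [c]. *)
have cN : c \in breaks V L.
  apply: contrapT => /negP cN; have [d d0 dN] := seq_gap (breaks V L) c.
  have [v [vN jv] vc] := Ec (d / 2) ltac:(lra).
  have cv := cE v (conj vN jv).
  have nb n : n \in breaks V L -> ~~ (c - d / 2 <= n <= v).
    move=> nN; apply/negP => h; have /(dN _ nN) : n != c by apply: contraNneq cN => <-.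
    by rewrite ler_normr; lra.
  have : E (c - d / 2).
    split.
      by apply/negP => /nb; lra.
    by rewrite (ljump_const Al lL _ nb)//; lra.
  by move=> /cE; lra.
(* For [x] between [c + t] and [c + 2 * t], the point [x - 2 * t] is left of [c], while [x - t] and
   [x] lie right of [c] and before the next break. *)
exists (c + t) => x cx xN xtN x2tN.
have [v [vN jv] vx] := Ec (x - t - c) ltac:(lra).
have cv : c < v.
  rewrite lt_neqAle cE// andbT; by apply: contraNneq vN => <-.
have nb n : n \in breaks V L -> ~~ (v <= n <= x).
  move=> nN; apply/negP => h; have nc : n != c by apply/eqP; lra.
  by have := sep _ _ nN cN nc; rewrite ger0_norm; lra.
have nb' n : n \in breaks V L -> ~~ (v <= n <= x - t).
  by move=> /nb; apply: contra => ?; lra.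
rewrite -(ljump_const Al lL _ nb); last by lra.
rewrite -(ljump_const Al lL _ nb'); last by lra.
have -> : ljump A l (x - 2 * t) = 0.
  apply: contrapT => /eqP j2; have : E (x - 2 * t) by [].
  by move=> /cE; lra.
move: jv; rewrite /ljump; case: (jump_cases (slice A v) (line l v)) => ->; lra.
Qed.

(** The condition on [t] says that the translation by [(t, t * a)] carries no line of another slope
    onto a parallel line of the list. Such lines then meet the translates at finitely many abscissas
    only. *)
Lemma kink_lined A V L (a t : R) : lined A V L -> 
  (forall l l', l \in L -> l' \in L -> l.1 = l'.1 -> l.1 != a -> l'.2 - l.2 != t * (l.1 - a)) ->
  exists N : seq R, forall x, x \notin N -> [/\ x \notin breaks V L, x - t \notin breaks V L &
    kink A (breaks V L) (cuts L) (t, t * a) x =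
    \sum_(l <- L | l.1 == a) ljump A l x * ljump A l (x - t)].
Proof.
move=> Al ta.
(* The last list holds the abscissas where a line [p.1] crosses the translate of a line [p.2] of
   another slope. *)
exists (breaks V L ++ [seq n + t | n <- breaks V L] ++
  [seq (p.2.2 - p.1.2 + t * (a - p.2.1)) / (p.1.1 - p.2.1) |
     p <- [seq (l, l') | l <- L, l' <- L]]) => x.
rewrite [x \in breaks V L ++ _]mem_cat negb_or => /andP[xN].
rewrite mem_cat negb_or => /andP[xtN xc].
have {}xtN : x - t \notin breaks V L.
  by apply: contra xtN => h; apply/mapP; exists (x - t); rewrite // subrK.
split=> //; rewrite /kink/= (negbTE xN) (negbTE xtN)/= /cuts big_map [RHS]big_mkcond/=.
rewrite big_seq [RHS]big_seq; apply: eq_bigr => l lL; rewrite /ljump.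
have [la|la] := eqVneq l.1 a.
  by congr (_ * jump _ _); rewrite /line la; ring.
have [_ /(_ _ xtN)[_ _ S]] := lined_sliced Al.
rewrite (jump0 S) ?mulr0//; apply/negP => /mapP[l' l'L E].
have [l1|l1] := eqVneq l.1 l'.1.
  have := ta _ _ lL l'L l1 la; move: E; rewrite /line l1 => E /eqP; apply; lra.
move/negP: xc; apply; apply/mapP; exists (l, l'); first by apply/allpairsP; exists (l, l').
have nz : l.1 - l'.1 != 0 by rewrite subr_eq0.
apply: (mulfI nz); rewrite /= [RHS]mulrC divfK//; move: E; rewrite /line; lra.
Qed.

(** With [h] separating the distinct intercepts and [M] bounding every [l.1 - a], the inequality
    [2 * t * M < h] keeps [s * (l.1 - a)] below every nonzero difference of intercepts; for equal
    intercepts this product is not 0. The two values of [s] are those of the two kinks to be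
    compared. *)
Lemma lined_small A V L (a : R) : lined A V L ->
  exists2 t0 : R, 0 < t0 & forall t, 0 < t < t0 ->
  (forall n n', n \in breaks V L -> n' \in breaks V L -> n != n' -> 2 * t < `|n - n'|) /\
  forall s, s = t \/ s = 2 * t ->
  forall l l', l \in L -> l' \in L -> l.1 = l'.1 -> l.1 != a -> l'.2 - l.2 != s * (l.1 - a).
Proof.
move=> Al.
have [g g0 gN] := seq_separated (breaks V L).
have [h h0 hL] := seq_separated [seq l.2 | l <- L].
pose M : R := 1 + \sum_(l <- L) `|l.1 - a|.
have sM l : l \in L -> `|l.1 - a| <= M.
  move=> lL; rewrite /M (big_rem l)//= addrCA lerDl.
  by rewrite addr_ge0// sumr_ge0.
have M0 : 0 < M by rewrite ltr_pwDl// sumr_ge0.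
pose m := Num.min g (h / M).
have m0 : 0 < m by rewrite lt_min g0 divr_gt0.
exists (m / 2) => [|t t0m]; first by lra.
have [tg th] : 2 * t < g /\ 2 * t < h / M.
  have : 2 * t < m by lra.
  by rewrite lt_min => /andP[].
split=> [n n' nN n'N nn'|s st l l' lL l'L l1 la].
  exact: lt_le_trans (gN _ _ nN n'N nn').
have s0 : 0 < s <= 2 * t by case: st => ->; lra.
have [l2|l2] := eqVneq l'.2 l.2.
  by rewrite l2 subrr eq_sym mulf_neq0// ?subr_eq0//; apply/eqP; lra.
apply/eqP => E; have := hL _ _ (map_f snd l'L) (map_f snd lL) l2.
rewrite E normrM leNgt; apply/negP; rewrite negbK.
apply: (@le_lt_trans _ _ (2 * t * M)).
  by rewrite ler_pM// ?sM// ger0_norm; lra.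
by rewrite -ltr_pdivlMr.
Qed.

(** Every line of [E] contributes at least 1 on an interval of length [t], and all other lines of
    slope [a] contribute a nonnegative amount, so signs of jumps cannot spoil the count. *)
Lemma lined_lower A V L (a : R) (E : seq (R * R)) : lined A V L -> uniq E ->
  (forall l, l \in E -> [/\ l \in L, l.1 = a &
     exists2 x, x \notin breaks V L & ljump A l x != 0]) ->
  exists2 t0 : R, 0 < t0 & forall t, 0 < t < t0 ->
  t * (size E)%:R <=
  \int[@lebesgue_measure R]_x kink A (breaks V L) (cuts L) (t, t * a) x -
  \int[@lebesgue_measure R]_x kink A (breaks V L) (cuts L) (2 * t, 2 * t * a) x.
Proof.
move=> Al uE EL; have [cA rA uL AL] := Al.
have [t0 t00 H] := lined_small a Al; exists t0 => // t tt0.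
have [sep ta] := H _ tt0.
have /choice[c cP] : forall l : R * R, exists c : R, l \in E -> forall x, c < x < c + t ->
  x \notin breaks V L -> x - t \notin breaks V L -> x - 2 * t \notin breaks V L ->
  1 <= ljump A l x * (ljump A l (x - t) - ljump A l (x - 2 * t)).
  move=> l; have [lE|lE] := boolP (l \in E); last by exists 0.
  have [lL l1 [x0 x0N jx0]] := EL _ lE.
  have t1 : 0 < t by lra.
  by have [c cP] := ljump_term_ge1 Al lL t1 sep x0N jx0; exists c.
have [N1 N1P] := kink_lined Al (ta t (or_introl erefl)).
have [N2 N2P] := kink_lined Al (ta (2 * t) (or_intror erefl)).
have [i1 _] := kink_cvg (t, t * a) (lined_sliced Al).
have [i2 _] := kink_cvg (2 * t, 2 * t * a) (lined_sliced Al).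
rewrite -RintegralB//.
have ic (l : R * R) : (@lebesgue_measure R).-integrable setT (EFin \o \1_`]c l, c l + t[%classic).
  exact: (integrable_indic_itv (c l) (c l + t) false true).
have -> : t * (size E)%:R =
    \int[@lebesgue_measure R]_x \sum_(l <- E) \1_`]c l, c l + t[%classic x.
  rewrite Rintegral_sum// -sum1_size natr_sum mulr_sumr.
  apply: eq_bigr => l _; rewrite Rintegral_indic//= lebesgue_measure_itv/=.
  by rewrite lte_fin ltrDl ifT /=; lra.
apply: (le_Rintegral_finite (N := N1 ++ N2)).
- move=> x; rewrite mem_cat negb_or => /andP[/N1P[xN xtN ->] /N2P[_ x2tN ->]].
  rewrite -sumrB; under [leRHS]eq_bigr do rewrite -mulrBr.
  have EF : {subset E <= [seq l <- L | l.1 == a]}.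
    by move=> l /EL[lL l1 _]; rewrite mem_filter l1 eqxx.
  apply: (@le_trans _ _ (\sum_(l <- E) ljump A l x * (ljump A l (x - t) - ljump A l (x - 2 * t)))).
    rewrite big_seq [leRHS]big_seq; apply: ler_sum => l lE.
    have [lL l1 _] := EL _ lE.
    rewrite indicE; have [xc|xc] := boolP (x \in `]c l, c l + t[%classic).
      by apply: cP => //; move: xc; rewrite inE/= in_itv.
    by apply: (ljump_term_ge0 Al) => //; lra.
  rewrite -[leRHS]big_filter.
  rewrite [leRHS](bigID (mem E))/= -[leLHS]addr0 lerD//.
    rewrite -[leRHS]big_filter le_eqVlt; apply/orP; left; apply/eqP.
    apply: perm_big; apply: uniq_perm; rewrite ?filter_uniq//.
    by move=> l; rewrite mem_filter/=; case: (boolP (l \in E)) => // /EF ->.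
  rewrite big_seq_cond sumr_ge0// => l /andP[+ _]; rewrite mem_filter => /andP[_ lL].
  by apply: (ljump_term_ge0 Al) => //; lra.
- exact: integrable_sumR.
- exact: (integrableB measurableT i1 i2).
Qed.

End lined_lower.

(** * Convex bodies *)

Lemma convex_setP (R : realType) (K : set (plane R)) :
  convex_set K <->
  (forall u v (s : R), K u -> K v -> 0 <= s <= 1 -> K (seg u v s)).
Proof.
have segE (u v : plane R) (s : R) : seg u v s = s *: v + (1 - s) *: u.
  by apply/pair_equal_spec; split; rewrite /= /GRing.scale/=; ring.
split=> [cK u v s Ku Kv /andP[s0 s1]|cK u v s].
  have := cK v u (Itv01 s0 s1); rewrite !inE => /(_ Kv Ku).
  by rewrite segE.
rewrite !inE => Ku Kv.
have := cK v u s%:num Kv Ku; rewrite segE; apply.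
by apply/andP; split.
Qed.

(** * Convex functions and their horizontal chords *)

Section convex_functions.
Variable R : realType.
Implicit Types (D : R -> Prop) (f g : R -> R).

(** Convexity with denominators cleared; [D] is an interval in all uses. *)
Definition cvx D f := forall x1 x2 x3, D x1 -> D x3 -> x1 < x2 < x3 ->
  (x3 - x1) * f x2 <= (x3 - x2) * f x1 + (x2 - x1) * f x3.

(** On either side of [c] there is at most one zero: of two, the one nearer to [c] would have a
    negative value by convexity. *)
Lemma cvx_zeros D f (c : R) : cvx D f -> D c -> f c < 0 ->
  exists N : seq R, forall x, D x -> f x = 0 -> x \in N.
Proof.
move=> cf Dc fc.
have [N1 HN1] : exists N : seq R, forall x, D x -> f x = 0 -> x < c -> x \in N.
  have [[x [Dx fx xc]]|nx] := pselect (exists x, [/\ D x, f x = 0 & x < c]); last first.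
    by exists [::] => x Dx fx xc; exfalso; apply: nx; exists x.
  exists [:: x] => x' Dx' fx' xc'; rewrite inE; apply/eqP.
  case: (ltgtP x x') => // xx'; exfalso.
    by have := cf _ _ _ Dx Dc (introT andP (conj xx' xc')); rewrite fx fx'; nra.
  by have := cf _ _ _ Dx' Dc (introT andP (conj xx' xc)); rewrite fx fx'; nra.
have [N2 HN2] : exists N : seq R, forall x, D x -> f x = 0 -> c < x -> x \in N.
  have [[x [Dx fx xc]]|nx] := pselect (exists x, [/\ D x, f x = 0 & c < x]); last first.
    by exists [::] => x Dx fx xc; exfalso; apply: nx; exists x.
  exists [:: x] => x' Dx' fx' xc'; rewrite inE; apply/eqP.
  case: (ltgtP x x') => // xx'; exfalso.
    by have := cf _ _ _ Dc Dx' (introT andP (conj xc xx')); rewrite fx fx'; nra.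
  by have := cf _ _ _ Dc Dx (introT andP (conj xc' xx')); rewrite fx fx'; nra.
exists (N1 ++ N2) => x Dx fx; rewrite mem_cat.
case: (ltgtP x c) => xc; first by rewrite HN1.
  by rewrite HN2 ?orbT.
by move: fc; rewrite -xc fx ltxx.
Qed.

Definition oint (p q : R) (x : R) := p < x < q.

(* The abscissas at which a boundary arc of a convex body adds to the kink at
   t (1, a) more than to the kink at 2 t (1, a). *)
Definition flatstep (p q : R) f (t x : R) :=
  [/\ oint p q x, oint p q (x - t), f x = f (x - t) &
      ~ (oint p q (x - 2 * t) /\ f x = f (x - 2 * t))].

(** If [x' > x + t], the horizontal chords over [[x - t, x]] and [[x' - t, x']] are disjoint, and
    convexity puts them at one height. The function is then constant on [[x - t, x']], which
    contains [x' - 2 * t]. *)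
Lemma flatstep_diam (p q : R) f (t x x' : R) : cvx (oint p q) f -> 0 < t ->
  flatstep p q f t x -> flatstep p q f t x' -> x' <= x + t.
Proof.
move=> cf t0 [Dx Dxt fx _] [Dx' Dxt' fx' nx']; rewrite leNgt; apply/negP => xx'.
apply: nx'; have D2 : oint p q (x' - 2 * t) by move: Dxt Dx'; rewrite /oint; lra.
split=> //.
have h1 := cf (x - t) x (x' - t) Dxt Dxt' ltac:(lra).
have h2 := cf x (x' - t) x' Dx Dx' ltac:(lra).
have e1 : f (x' - t) = f x.
  apply/eqP; rewrite eq_le; apply/andP; split; rewrite -(ler_pM2l t0).
    by rewrite -fx' in h2; nra.
  by rewrite -fx in h1; nra.
have h3 := cf (x - t) (x' - 2 * t) x' Dxt Dx' ltac:(lra).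
have h4 := cf (x' - 2 * t) (x' - t) x' D2 Dx' ltac:(lra).
apply/eqP; rewrite eq_le; apply/andP; split.
  by rewrite -(ler_pM2l t0); move: h4; rewrite fx' e1; nra.
have pos : 0 < x' - (x - t) by lra.
rewrite -(ler_pM2l pos); move: h3; rewrite fx' e1 -fx; lra.
Qed.

(** Two distinct horizontal chords of the same length can occur only on the plateau where a convex
    function attains its minimum. *)
Lemma flatstep_min (p q : R) f (t x x' : R) : cvx (oint p q) f -> 0 < t ->
  flatstep p q f t x -> flatstep p q f t x' -> x < x' ->
  f (x - t) = f x /\ forall y, oint p q y -> f x <= f y.
Proof.
move=> cf t0 [Dx Dxt fx _] [Dx' Dxt' fx' _] xx'; split=> //.
have e : f x' = f x.
  have h1 := cf (x - t) x x' Dxt Dx' ltac:(lra).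
  have ge : f x <= f x' by rewrite -(ler_pM2l t0); move: h1; rewrite -fx; nra.
  apply/eqP; rewrite eq_le ge andbT fx'.
  case: (ltgtP (x' - t) x) => xt; last by rewrite xt.
  - have h2 := cf (x - t) (x' - t) x Dxt Dx ltac:(lra).
    by rewrite -(ler_pM2l t0); move: h2; rewrite -fx; lra.
  - have h2 := cf x (x' - t) x' Dx Dx' ltac:(lra).
    have pos : 0 < x' - t - x by lra.
    by rewrite -(ler_pM2l t0); move: h2; rewrite -fx'; nra.
move=> y Dy; case: (ltgtP y x) => yx; last by rewrite yx.
- have h := cf y x x' Dy Dx' ltac:(lra).
  have pos : 0 < x' - x by lra.
  by rewrite -(ler_pM2l pos); move: h; rewrite e; lra.
- have h := cf (x - t) x y Dxt Dy ltac:(lra).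
  by rewrite -(ler_pM2l t0); move: h; rewrite -fx; lra.
Qed.

Lemma flatstep_bound (p q : R) f (t : R) : cvx (oint p q) f -> 0 < t ->
  exists c : R, forall x, flatstep p q f t x -> c <= x <= c + t.
Proof.
move=> cf t0; have [[x0 Wx0]|nW] := pselect (exists x, flatstep p q f t x); last first.
  by exists 0 => x Wx; exfalso; apply: nW; exists x.
pose W := [set x | flatstep p q f t x].
have hW : has_inf W.
  split; first by exists x0.
  exists p => x [+ _ _ _]; rewrite /oint; lra.
exists (inf W) => x Wx; rewrite ge_inf//=; last by case: hW.
rewrite -lerBlDr; apply: lb_le_inf; first by case: hW.
by move=> y Wy; have := flatstep_diam cf t0 Wy Wx; lra.
Qed.

End convex_functions.

Lemma slice_closed (R : realType) (A : set (plane R)) (x : R) :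
  closed A -> closed (slice A x).
Proof.
move=> cA; have -> : slice A x = (fun s : R => (x + s * 0, 0 + s * 1) : plane R) @^-1` A.
  by apply/funext => y; rewrite /slice/preimage/= mulr0 addr0 add0r mulr1.
apply: closed_comp => // y _.
exact: (@affine_continuous R (x, 0) (0, 1)).
Qed.

Lemma closed_sup (R : realType) (S : set R) : closed S -> has_sup S -> S (sup S).
Proof.
by move=> cS [S0 Sb]; rewrite [X in X (sup S)]((closure_id S).1 cS); exact: closure_sup.
Qed.

Lemma closed_inf (R : realType) (S : set R) : closed S -> has_inf S -> S (inf S).
Proof.
move=> cS [S0 Sb]; have : closed [set - x | x in S].
  have -> : [set - x | x in S] = -%R @^-1` S.
    by apply/seteqP; split=> [_ [x Sx <-]|x Sx]; rewrite /preimage/= ?opprK//; exists (- x); rewrite ?opprK.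
  by apply: closed_comp => // x _; exact: opp_continuous.
move=> /closed_sup; case; first by apply/has_inf_supN.
by move=> x Sx; rewrite /inf => <-; rewrite opprK.
Qed.

(** * Slices and kinks of a convex body *)

Section convex_slices.
Variable R : realType.
Variable K : set (plane R).
Hypothesis hK : convex_body K.

Let cK : compact K. Proof. by case: hK. Qed.
Let vK u v (s : R) : K u -> K v -> 0 <= s <= 1 -> K (seg u v s).
Proof. by case: hK => /convex_setP h _ _; exact: h. Qed.

Definition lo (K : set (plane R)) (x : R) : R := inf (slice K x).
Definition hi (K : set (plane R)) (x : R) : R := sup (slice K x).
Definition xmin (K : set (plane R)) : R := inf [set u.1 | u in K].
Definition xmax (K : set (plane R)) : R := sup [set u.1 | u in K].
(** The end abscissas are left out, as the slice there may be a single point. *)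
Definition dom K := oint (xmin K) (xmax K).

Lemma slice_bounds (x y : R) : K (x, y) ->
  [/\ K (x, lo K x), K (x, hi K x), lo K x <= y, y <= hi K x & xmin K <= x <= xmax K].
Proof.
move=> Kxy; have [L L0 KL] := compact_box cK.
have cl : closed (slice K x) by apply: slice_closed; exact: compact_closed.
have hi_ : has_sup (slice K x).
  by split; [exists y | exists L => z /KL[_]; rewrite ler_norml => /andP[]].
have hl_ : has_inf (slice K x).
  by split; [exists y | exists (- L) => z /KL[_]; rewrite ler_norml => /andP[]].
split.
- exact: (closed_inf cl hl_).
- exact: (closed_sup cl hi_).
- by apply: ge_inf => //; case: hl_.
- by apply: ub_le_sup => //; case: hi_.
- apply/andP; split.
    apply: ge_inf; last by exists (x, y).
    by exists (- L) => _ [[u v] /KL[+ _] <-]; rewrite ler_norml => /andP[].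
  apply: ub_le_sup; last by exists (x, y).
  by exists L => _ [[u v] /KL[+ _] <-]; rewrite ler_norml => /andP[].
Qed.

Lemma body_center : exists2 u : plane R, dom K u.1 & exists2 e : R, 0 < e &
  forall x y : R, `|x - u.1| <= e -> `|y - u.2| <= e -> K (x, y).
Proof.
have [_ _ [u Ku]] := hK; have /nbhs_plane[e e0 eK] : nbhs u K by exact: Ku.
have H (x y : R) : `|x - u.1| <= e / 2 -> `|y - u.2| <= e / 2 -> K (x, y).
  by move=> hx hy; apply: eK; lra.
exists u; last by exists (e / 2); rewrite // divr_gt0.
have K1 : K (u.1 + e / 2, u.2).
  by apply: H; rewrite ?subrr ?normr0 ?[_ + e / 2]addrC ?addrK ?ger0_norm; lra.
have K2 : K (u.1 - e / 2, u.2).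
  by apply: H; rewrite ?subrr ?normr0 ?[_ - e / 2]addrC ?addrK ?normrN ?ger0_norm; lra.
have [_ _ _ _ h1] := slice_bounds K1; have [_ _ _ _ h2] := slice_bounds K2.
by rewrite /dom /oint; lra.
Qed.

(** Take a box around a center and a point [u] of [K] beyond [x]. The segments from the box to [u]
    cross the vertical above [x] in a nondegenerate interval, since [s < 1]. *)
Lemma dom_slice (x : R) : dom K x ->
  [/\ K (x, lo K x), K (x, hi K x) & lo K x < hi K x].
Proof.
move=> Dx; have [c Dc [e e0 eK]] := body_center.
have [L L0 KL] := compact_box cK.
have [u Ku cxu] : exists2 u : plane R, K u &
    exists2 s : R, 0 <= s < 1 & x = c.1 + s * (u.1 - c.1).
  have Kc : K c by rewrite [c]surjective_pairing; apply: eK; rewrite subrr normr0 ltW.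
  have hs (u : plane R) : K u -> (c.1 <= x < u.1) || (u.1 < x <= c.1) ->
      exists2 s : R, 0 <= s < 1 & x = c.1 + s * (u.1 - c.1).
    move=> Ku h; have nz : u.1 - c.1 != 0 by apply/eqP => E; lra.
    exists ((x - c.1) / (u.1 - c.1)); last by rewrite divfK//; ring.
    case/orP: h => h.
      have p : 0 < u.1 - c.1 by lra.
      by rewrite ler_pdivlMr// ltr_pdivrMr// mul0r mul1r; lra.
    have p : 0 < c.1 - u.1 by lra.
    rewrite -[_ / _]mulrNN -invrN !opprB ler_pdivlMr// ltr_pdivrMr// mul0r mul1r; lra.
  have [v Kv] : exists v, K v by exists c; rewrite [c]surjective_pairing; apply: eK; rewrite subrr normr0 ltW.
  have ne : [set u.1 | u in K] !=set0 by exists v.1, v.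
  have [xc|xc] := leP c.1 x.
    have [_ [u Ku <-] xu] : exists2 w, [set u.1 | u in K] w & x < w.
      by apply: sup_gt => //; move: Dx; rewrite /dom /oint /xmax; lra.
    by exists u => //; apply: hs => //; lra.
  have [_ [u Ku <-] xu] : exists2 w, [set u.1 | u in K] w & w < x.
    by apply: inf_lt => //; move: Dx; rewrite /dom /oint /xmin; lra.
  by exists u => //; apply: hs => //; lra.
have [s s01 xE] := cxu.
have Ks (f : R) : `|f| <= e -> K (x, c.2 + f + s * (u.2 - (c.2 + f))).
  move=> fe; have Kcf : K (c.1, c.2 + f).
    apply: eK; first by rewrite subrr normr0 ltW.
    by rewrite [_ + f]addrC addrK.
  have := vK Kcf Ku (s := s); rewrite /seg/= -xE; apply; lra.
have [K1 K2 h1 _ _] := slice_bounds (Ks (- e) ltac:(rewrite normrN ger0_norm; lra)).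
have [_ _ _ h2 _] := slice_bounds (Ks e ltac:(rewrite ger0_norm; lra)).
by split => //; nra.
Qed.

Lemma slice_dom (x : R) : dom K x -> slice K x = [set y | lo K x <= y <= hi K x].
Proof.
move=> Dx; have [K1 K2 h] := dom_slice Dx; apply/seteqP; split=> y /=.
  by move=> /slice_bounds[_ _ -> ->].
move=> yh; have hl : hi K x - lo K x != 0 by apply/eqP; lra.
have := vK K1 K2 (s := (y - lo K x) / (hi K x - lo K x)); rewrite /seg/= subrr mulr0 addr0.
rewrite divfK// subrKC; apply.
have p : 0 < hi K x - lo K x by lra.
by rewrite ler_pdivlMr// ler_pdivrMr// mul0r mul1r; lra.
Qed.

Lemma slice_out (x : R) : x \notin [:: xmin K; xmax K] -> ~~ dom K x -> slice K x = set0.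
Proof.
rewrite !inE negb_or => /andP[/eqP x1 /eqP x2] nD.
apply/seteqP; split=> y //= /slice_bounds[_ _ _ _ h]; move/negP: nD; apply.
rewrite /dom /oint; lra.
Qed.

Definition body_cuts K (x : R) : seq R := if dom K x then [:: lo K x; hi K x] else [::].

Lemma stepset0 : @stepset R set0 [::].
Proof. by []. Qed.

Lemma body_sliced : sliced K [:: xmin K; xmax K] (body_cuts K) 2.
Proof.
split=> // x xN; rewrite /body_cuts; case: ifPn => Dx; last first.
  by rewrite (slice_out xN Dx).
have [_ _ h] := dom_slice Dx; split=> //.
  by rewrite /= inE andbT; apply/eqP; lra.
rewrite slice_dom// => y y' yy' nb; apply/propext => /=.
have := nb (lo K x); rewrite !inE eqxx => /(_ isT).
have := nb (hi K x); rewrite !inE eqxx orbT => /(_ isT).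
by rewrite !negb_and -!ltNge; split; lra.
Qed.

Lemma jump_itv (l h b : R) : l < h ->
  jump [set y | l <= y <= h] b = (b == l)%:R - (b == h)%:R.
Proof.
move=> lh; have SB : stepset [set y | l <= y <= h] [:: l; h].
  move=> y y' yy' nb; apply/propext => /=.
  have := nb l; rewrite !inE eqxx => /(_ isT).
  have := nb h; rewrite !inE eqxx orbT => /(_ isT).
  by rewrite !negb_and -!ltNge; split; lra.
have [bl|bl] := eqVneq b l.
  have -> : (b == h) = false by apply/eqP; lra.
  rewrite /jump bl asboolT; last by exists (h - l) => [|e /=]; lra.
  rewrite asboolF ?subr0// => -[d d0 H].
  by have := H (d / 2) ltac:(lra) => /=; lra.
have [bh|bh] := eqVneq b h.
  rewrite /jump bh asboolF; last first.
    by move=> -[d d0 H]; have := H (d / 2) ltac:(lra) => /=; lra.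
  by rewrite asboolT//; exists (h - l) => [|e /=]; lra.
by rewrite (jump0 SB) ?subrr// !inE negb_or bl bh.
Qed.

(** Lower ends have jump 1 and upper ends jump -1: ends of the same kind that coincide count 1, ends
    of opposite kinds -1. *)
Lemma body_kink (a b x : R) :
  x \notin [:: xmin K; xmax K] -> x - a \notin [:: xmin K; xmax K] ->
  kink K [:: xmin K; xmax K] (body_cuts K) (a, b) x =
  if dom K x && dom K (x - a) then
    ((lo K x - b == lo K (x - a))%:R - (lo K x - b == hi K (x - a))%:R)
  - ((hi K x - b == lo K (x - a))%:R - (hi K x - b == hi K (x - a))%:R)
  else 0.
Proof.
move=> xN xaN; rewrite /kink (negbTE xN) (negbTE xaN)/= /body_cuts.
case: (boolP (dom K x)) => Dx /=; last by rewrite big_nil.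
rewrite big_cons big_seq1.
case: ifPn => Dxa; last first.
  by rewrite (slice_out xaN Dxa) !(jump0 stepset0)// !mulr0 addr0.
have [_ _ h] := dom_slice Dx; have [_ _ h'] := dom_slice Dxa.
rewrite !slice_dom// !jump_itv// !eqxx.
have -> : (lo K x == hi K x) = false by apply/eqP; lra.
have -> : (hi K x == lo K x) = false by apply/eqP; lra.
by rewrite /= mulr0n mulr1n subr0 sub0r mul1r mulN1r.
Qed.

(** The tilt by [a] makes chords of slope [a] horizontal, as required by [flatstep]. *)
Lemma lo_cvx (a : R) : cvx (dom K) (fun x => lo K x - a * x).
Proof.
move=> x1 x2 x3 D1 D3 x123; have [K1 _ _] := dom_slice D1; have [K3 _ _] := dom_slice D3.
have p : 0 < x3 - x1 by lra.
pose s := (x2 - x1) / (x3 - x1).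
have sE : s * (x3 - x1) = x2 - x1 by rewrite /s divfK//; apply/eqP; lra.
have s01 : 0 <= s <= 1 by rewrite /s ler_pdivlMr// ler_pdivrMr// mul0r mul1r; lra.
have := vK K1 K3 s01; rewrite /seg/= sE subrKC => /slice_bounds[_ _ h _ _].
have := ler_wpM2l (ltW p) h.
have -> : (x3 - x1) * (lo K x1 + s * (lo K x3 - lo K x1)) =
  (x3 - x1) * lo K x1 + (s * (x3 - x1)) * (lo K x3 - lo K x1) by ring.
rewrite sE; nra.
Qed.

Lemma hi_cvx (a : R) : cvx (dom K) (fun x => - (hi K x - a * x)).
Proof.
move=> x1 x2 x3 D1 D3 x123; have [_ K1 _] := dom_slice D1; have [_ K3 _] := dom_slice D3.
have p : 0 < x3 - x1 by lra.
pose s := (x2 - x1) / (x3 - x1).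
have sE : s * (x3 - x1) = x2 - x1 by rewrite /s divfK//; apply/eqP; lra.
have s01 : 0 <= s <= 1 by rewrite /s ler_pdivlMr// ler_pdivrMr// mul0r mul1r; lra.
have := vK K1 K3 s01; rewrite /seg/= sE subrKC => /slice_bounds[_ _ _ h _].
have := ler_wpM2l (ltW p) h.
have -> : (x3 - x1) * (hi K x1 + s * (hi K x3 - hi K x1)) =
  (x3 - x1) * hi K x1 + (s * (x3 - x1)) * (hi K x3 - hi K x1) by ring.
rewrite sE; nra.
Qed.

(** The lower supporting line of slope [a] touches [K] in a nondegenerate segment; [flat_top] is the
    upper counterpart. *)
Definition flat_bottom K (a : R) := exists m x1 x2 : R,
  [/\ x1 < x2, K (x1, a * x1 + m), K (x2, a * x2 + m) &
      forall x y : R, K (x, y) -> m <= y - a * x].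
Definition flat_top K (a : R) := exists m x1 x2 : R,
  [/\ x1 < x2, K (x1, a * x1 + m), K (x2, a * x2 + m) &
      forall x y : R, K (x, y) -> y - a * x <= m].

Lemma seg_dom (u : plane R) (x s : R) : K u -> dom K x -> 0 < s <= 1 ->
  dom K (u.1 + s * (x - u.1)).
Proof.
move=> Ku; have : K (u.1, u.2) by rewrite -surjective_pairing.
move=> /slice_bounds[_ _ _ _]; rewrite /dom /oint; set p := xmin K; set q := xmax K.
set w := u.1 => wp xp sp; nra.
Qed.

Lemma flatstep_bottom (a t x x' : R) : 0 < t ->
  flatstep (xmin K) (xmax K) (fun x => lo K x - a * x) t x ->
  flatstep (xmin K) (xmax K) (fun x => lo K x - a * x) t x' -> x < x' ->
  flat_bottom K a.
Proof.
move=> t0 Wx Wx' xx'; have [E mn] := flatstep_min (@lo_cvx a) t0 Wx Wx' xx'.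
have [Dx Dxt _ _] := Wx.
have [K1 _ _] := dom_slice Dx; have [K2 _ _] := dom_slice Dxt.
exists (lo K x - a * x), (x - t), x; split.
- lra.
- by rewrite -E subrKC.
- by rewrite subrKC.
move=> x0 y0 K0; have := slice_bounds K1; move=> _.
(* Minimality is known over [dom K] only, and [x0] may be an end abscissa. It is tested inside the
   segment towards a bottom point, where the midpoint suffices. *)
have h (s : R) : 0 < s <= 1 ->
    lo K x - a * x <= (1 - s) * (y0 - a * x0) + s * (lo K x - a * x).
  move=> s01; have Ds := seg_dom K0 Dx s01.
  have /slice_bounds[_ _ h _ _] := vK K0 K1 (s := s) ltac:(lra).
  by have := mn _ Ds; move: h; rewrite /seg/=; lra.
by have := h (1 / 2) ltac:(lra); lra.
Qed.

Lemma flatstep_top (a t x x' : R) : 0 < t ->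
  flatstep (xmin K) (xmax K) (fun x => - (hi K x - a * x)) t x ->
  flatstep (xmin K) (xmax K) (fun x => - (hi K x - a * x)) t x' -> x < x' ->
  flat_top K a.
Proof.
move=> t0 Wx Wx' xx'; have [E mn] := flatstep_min (@hi_cvx a) t0 Wx Wx' xx'.
have [Dx Dxt _ _] := Wx.
have [_ K1 _] := dom_slice Dx; have [_ K2 _] := dom_slice Dxt.
exists (hi K x - a * x), (x - t), x; split.
- lra.
- by rewrite -[hi K x - a * x](oppr_inj E) subrKC.
- by rewrite subrKC.
move=> x0 y0 K0.
have h (s : R) : 0 < s <= 1 ->
    (1 - s) * (y0 - a * x0) + s * (hi K x - a * x) <= hi K x - a * x.
  move=> s01; have Ds := seg_dom K0 Dx s01.
  have /slice_bounds[_ _ _ h _] := vK K0 K1 (s := s) ltac:(lra).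
  by have := mn _ Ds; move: h; rewrite /seg/=; lra.
by have := h (1 / 2) ltac:(lra); lra.
Qed.

(** The height of the lower end of one slice minus that of the upper end of the other, suitably
    shifted, is convex in [x]. For small [t] it is negative above the center of a box contained in
    [K], so [cvx_zeros] applies. *)
Lemma cross_finite (a : R) : exists2 t0 : R, 0 < t0 & forall t, 0 < t < t0 ->
  exists N : seq R, forall x, dom K x -> dom K (x - t) ->
    (hi K x - t * a == lo K (x - t)) || (lo K x - t * a == hi K (x - t)) -> x \in N.
Proof.
have [c Dc [e e0 eK]] := body_center.
have De : dom K c.1 /\ forall x : R, `|x - (c.1 : R)| <= e -> lo K x <= c.2 - e /\ c.2 + e <= hi K x.
  split=> // x xe; split.
    have /slice_bounds[_ _ + _ _] : K (x, c.2 - e); last by [].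
    by apply: eK => //; rewrite addrAC subrr sub0r normrN ger0_norm; lra.
  have /slice_bounds[_ _ _ + _] : K (x, c.2 + e); last by [].
  by apply: eK => //; rewrite addrAC subrr add0r ger0_norm; lra.
have {De}[_ De] := De.
pose k := `|a| + 1; have k0 : 0 < k by rewrite ltr_wpDl.
(* These bounds keep [c.1 - t] within the box and in [dom K], and [t * a] smaller than [e] in
   absolute value. *)
pose t0 := Num.min (Num.min e (e / k)) (Num.min (c.1 - xmin K) (xmax K - c.1)).
exists t0 => [|t /andP[t_0]].
  by move: Dc; rewrite /dom /oint !lt_min e0 divr_gt0//= !subr_gt0 => /andP[-> ->].
rewrite !lt_min => /andP[/andP[te tk] /andP[tp tq]].
have ta : `|t * a| < e.
  move: tk; rewrite ltr_pdivlMr// normrM ger0_norm ?ltW//; apply: le_lt_trans.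
  by apply: ler_wpM2l; [exact: ltW | rewrite /k; lra].
have Dt : dom K (c.1 - t) by move: Dc; rewrite /dom /oint; lra.
pose D x := dom K x /\ dom K (x - t).
have [lc hc] := De c.1 ltac:(rewrite subrr normr0; lra).
have [lct hct] := De (c.1 - t) ltac:(rewrite addrAC subrr sub0r normrN ger0_norm; lra).
have ta' : - e < t * a < e by rewrite -ltr_norml.
have shift f x1 x2 x3 : cvx (dom K) f -> D x1 -> D x3 -> x1 < x2 < x3 ->
    (x3 - x1) * f (x2 - t) <= (x3 - x2) * f (x1 - t) + (x2 - x1) * f (x3 - t).
  move=> cf [_ D1] [_ D3] h; have := cf (x1 - t) (x2 - t) (x3 - t) D1 D3 ltac:(lra); lra.
have [N1 H1] : exists N : seq R, forall x, D x -> - (hi K x - t * a - lo K (x - t)) = 0 -> x \in N.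
  apply: (@cvx_zeros _ D _ c.1) => [x1 x2 x3 D1 D3 h||]; [|by split|by lra].
  have := shift _ _ _ _ (@lo_cvx 0) D1 D3 h.
  have := @hi_cvx 0 _ _ _ (proj1 D1) (proj1 D3) h; lra.
have [N2 H2] : exists N : seq R, forall x, D x -> lo K x - t * a - hi K (x - t) = 0 -> x \in N.
  apply: (@cvx_zeros _ D _ c.1) => [x1 x2 x3 D1 D3 h||]; [|by split|by lra].
  have := shift _ _ _ _ (@hi_cvx 0) D1 D3 h.
  have := @lo_cvx 0 _ _ _ (proj1 D1) (proj1 D3) h; lra.
exists (N1 ++ N2) => x Dx Dxt; rewrite mem_cat => /orP[/eqP E|/eqP E].
  by rewrite H1//; lra.
by rewrite (H2 x) ?orbT//; lra.
Qed.

End convex_slices.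

(** * Upper bound: each flat face of a convex body contributes at most t *)

(** If [P] fails there is at most one flat step, which goes into the exceptional list [N]. *)
Lemma flatstep_itv (R : realType) (p q : R) f (t : R) (P : Prop) :
  cvx (oint p q) f -> 0 < t ->
  (forall x x', flatstep p q f t x -> flatstep p q f t x' -> x < x' -> P) ->
  exists (N : seq R) (c : R), forall x, x \notin N -> flatstep p q f t x ->
    P /\ c <= x <= c + t.
Proof.
move=> cf t0 fP; have [c cP] := flatstep_bound cf t0.
have [hP|nP] := pselect P; first by exists [::], c => x _ /cP.
have [[x0 Wx0]|nW] := pselect (exists x, flatstep p q f t x); last first.
  by exists [::], c => x _ Wx; exfalso; apply: nW; exists x.
exists [:: x0], c => x; rewrite inE => /eqP xx0 Wx; exfalso; apply: nP.
by case: (ltgtP x x0) => // h; [exact: (fP x x0) | exact: (fP x0 x)].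
Qed.

(** A coincidence of ends of the same kind counted at [t] but not at [2 * t] is a flat step.
    Opposite ends count negatively at [t], which only helps, and by [cross_finite] they coincide at
    finitely many abscissas at [2 * t]. *)
Lemma body_upper (R : realType) (K : set (plane R)) (a : R) : convex_body K ->
  exists2 t0 : R, 0 < t0 & forall t, 0 < t < t0 ->
  \int[@lebesgue_measure R]_x kink K [:: xmin K; xmax K] (body_cuts K) (t, t * a) x -
  \int[@lebesgue_measure R]_x kink K [:: xmin K; xmax K] (body_cuts K) (2 * t, 2 * t * a) x
  <= t * ((`[<flat_bottom K a>])%:R + (`[<flat_top K a>])%:R).
Proof.
move=> hK; have [t0 t00 cr] := cross_finite hK a.
(* Halved because [cross_finite] is applied to [2 * t]. *)
exists (t0 / 2) => [|t tt0]; first by lra.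
have t1 : 0 < t by lra.
have [N4 N4P] := cr (2 * t) ltac:(lra).
have [N1 [c1 P1]] := flatstep_itv (@lo_cvx _ _ hK a) t1
  (fun x x' Wx Wx' xx' => flatstep_bottom hK t1 Wx Wx' xx').
have [N2 [c2 P2]] := flatstep_itv (@hi_cvx _ _ hK a) t1
  (fun x x' Wx Wx' xx' => flatstep_top hK t1 Wx Wx' xx').
have bs := body_sliced hK.
have [i1 _] := kink_cvg (t, t * a) bs.
have [i2 _] := kink_cvg (2 * t, 2 * t * a) bs.
rewrite -RintegralB//.
set fb : R := (`[<flat_bottom K a>])%:R; set ft : R := (`[<flat_top K a>])%:R.
have ic (c : R) : (@lebesgue_measure R).-integrable setT (EFin \o \1_`[c, c + t]%classic).
  exact: (integrable_indic_itv c (c + t) true false).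
have ibc (b c : R) : (@lebesgue_measure R).-integrable setT
    (EFin \o (fun x => b * \1_`[c, c + t]%classic x)).
  exact: (integrableZl measurableT b (ic c)).
have I1 (c : R) : \int[@lebesgue_measure R]_x (\1_`[c, c + t]%classic x : R) = t.
  by rewrite Rintegral_indic//= lebesgue_measure_itv/= lte_fin ltrDl t1 /=; lra.
have -> : t * (fb + ft) = \int[@lebesgue_measure R]_x
    (fb * \1_`[c1, c1 + t]%classic x + ft * \1_`[c2, c2 + t]%classic x).
  by rewrite RintegralD// !RintegralZl// !I1; ring.
pose N0 := [:: xmin K; xmax K].
apply: (le_Rintegral_finite (N := N0 ++ [seq n + t | n <- N0] ++ [seq n + 2 * t | n <- N0]
   ++ N1 ++ N2 ++ N4)); first last.
- exact: (integrableD measurableT (ibc _ _) (ibc _ _)).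
- exact: (integrableB measurableT i1 i2).
move=> x; rewrite mem_cat negb_or => /andP[xN]; rewrite mem_cat negb_or => /andP[xtN].
rewrite mem_cat negb_or => /andP[x2tN]; rewrite mem_cat negb_or => /andP[x1].
rewrite mem_cat negb_or => /andP[x2 x4].
have sh s : x \notin [seq n + s | n <- N0] -> x - s \notin N0.
  by apply: contra => h; apply/mapP; exists (x - s); rewrite // subrK.
have {}xtN := sh _ xtN; have {}x2tN := sh _ x2tN.
rewrite !body_kink//.
have fb0 : 0 <= fb by rewrite ler0n.
have ft0 : 0 <= ft by rewrite ler0n.
have g1 : 0 <= fb * \1_`[c1, c1 + t]%classic x by rewrite mulr_ge0// indicE ler0n.
have g2 : 0 <= ft * \1_`[c2, c2 + t]%classic x by rewrite mulr_ge0// indicE ler0n.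
have [/andP[Dx Dxt]|nD] := boolP (dom K x && dom K (x - t)); last first.
  (* [dom K] is an interval: if it contains [x] and [x - 2 * t], it contains [x - t]. *)
  rewrite ifF ?subr0 ?addr_ge0//; apply/negP => /andP[Dx D2]; move/negP: nD; apply.
  by rewrite Dx; move: Dx D2; rewrite /dom /oint; lra.
have f1 : flatstep (xmin K) (xmax K) (fun x => lo K x - a * x) t x ->
    fb * \1_`[c1, c1 + t]%classic x = 1.
  by move=> /(P1 _ x1)[h xc]; rewrite /fb asboolT// mul1r indicE mem_set.
have f2 : flatstep (xmin K) (xmax K) (fun x => - (hi K x - a * x)) t x ->
    ft * \1_`[c2, c2 + t]%classic x = 1.
  by move=> /(P2 _ x2)[h xc]; rewrite /ft asboolT// mul1r indicE mem_set.
have b01 (b : bool) : 0 <= (b%:R : R) <= 1 by case: b; rewrite ler01 lexx.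
rewrite Dx/=.
set B1 := lo K x - t * a == _; set C1 := lo K x - t * a == _.
set C2 := hi K x - t * a == _; set H1 := hi K x - t * a == _.
have nC1 := b01 C1; have nC2 := b01 C2.
have [D2|D2] := boolP (dom K (x - 2 * t)).
  set B2 := lo K x - 2 * t * a == _; set C3 := lo K x - 2 * t * a == _.
  set C4 := hi K x - 2 * t * a == _; set H2 := hi K x - 2 * t * a == _.
  have /negbTE C3F : ~~ C3.
    by apply: contra x4 => h; apply: N4P => //; rewrite -/C3 h orbT.
  have /negbTE C4F : ~~ C4 by apply: contra x4 => h; apply: N4P => //; rewrite -/C4 h.
  rewrite C3F C4F /=.
  have le1 : B1%:R - B2%:R <= fb * \1_`[c1, c1 + t]%classic x.
    case: (boolP B1) => [/eqP E1|_]; last by have := b01 B2; rewrite mulr0n; lra.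
    case: (boolP B2) => [_|/eqP E2]; first by rewrite subrr.
    rewrite f1 ?subr0//; split=> //; first by lra.
    by move=> [_ E]; apply: E2; lra.
  have le2 : H1%:R - H2%:R <= ft * \1_`[c2, c2 + t]%classic x.
    case: (boolP H1) => [/eqP E1|_]; last by have := b01 H2; rewrite mulr0n; lra.
    case: (boolP H2) => [_|/eqP E2]; first by rewrite subrr.
    rewrite f2 ?subr0//; split=> //; first by lra.
    by move=> [_ E]; apply: E2; lra.
  lra.
have le1 : B1%:R <= fb * \1_`[c1, c1 + t]%classic x.
  case: (boolP B1) => [/eqP E1|_//].
  by rewrite f1//; split=> //; [lra|case=> h; rewrite /dom h in D2].
have le2 : H1%:R <= ft * \1_`[c2, c2 + t]%classic x.
  case: (boolP H1) => [/eqP E1|_//].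
  by rewrite f2//; split=> //; [lra|case=> h; rewrite /dom h in D2].
lra.
Qed.

(** * Difference sets and faces *)

(** With the empty list it merely picks a point of the interval. *)
Lemma avoid_seq (R : realType) (N : seq R) (a b : R) : a < b ->
  exists2 s, a < s < b & s \notin N.
Proof.
move=> ab; have [d d0 dN] := seq_gap N a.
pose m := Num.min d (b - a).
have m0 : 0 < m by rewrite lt_min d0; lra.
have [md mb] : m <= d /\ m <= b - a by rewrite /m !ge_min !lexx orbT.
exists (a + m / 2); first by lra.
apply/negP => aN; have /(dN _ aN) : a + m / 2 != a by apply/eqP; lra.
by rewrite addrAC subrr add0r ger0_norm; lra.
Qed.

(** Equal boxes around [u] and [v] lie in [A], so the intersection of [A] with its translate
    contains the box around [u]. *)
Lemma covariogram_gt0 (R : realType) (A : set (plane R)) (u v : plane R) :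
  compact A -> A° u -> A° v -> 0 < covariogram A (u - v).
Proof.
move=> cA /nbhs_plane[e1 e10 Au] /nbhs_plane[e2 e20 Av].
pose e := Num.min e1 e2 / 2.
have [e0 [ee1 ee2]] : 0 < e /\ e < e1 /\ e < e2.
  have m0 : 0 < Num.min e1 e2 by rewrite lt_min e10.
  have m1 : Num.min e1 e2 <= e1 by rewrite ge_min lexx.
  have m2 : Num.min e1 e2 <= e2 by rewrite ge_min lexx orbT.
  by rewrite /e; lra.
have [i1 ->] := covariogram_sections (u - v) cA.
pose f x : R := 2 * e * \1_`[u.1 - e, u.1 + e]%classic x.
have i2 := integrable_indic_itv (u.1 - e) (u.1 + e) true false.
have if_ : (@lebesgue_measure R).-integrable setT (EFin \o f).
  exact: (integrableZl measurableT (2 * e) i2).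
apply: (@lt_le_trans _ _ (\int[@lebesgue_measure R]_x f x)).
  rewrite RintegralZl// Rintegral_indic//= lebesgue_measure_itv/= lte_fin ifT/=; last by lra.
  by rewrite mulr_gt0; lra.
apply: le_Rintegral => // x _; rewrite /f indicE.
have [xu|xu] := boolP (x \in `[u.1 - e, u.1 + e]%classic); last first.
  by rewrite mulr0; apply: fine_ge0; exact: measure_ge0.
rewrite mulr1 /cov_section; move: xu; rewrite inE/= in_itv/= => xu.
set S := _ `&` _.
have [mA Aoo] := slice_measurable x cA.
have [mA' _] := slice_measurable (x - (u - v).1) cA.
have [mA'' _] := lebesgue_measure_shift (u - v).2 mA'.
have mS : measurable (S : set (measurableTypeR R)) by exact: measurableI.
have Soo : (lebesgue_measure S < +oo)%E.
  by apply: le_lt_trans Aoo; apply: le_measure; rewrite ?inE//; exact: subIsetl.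
rewrite -lee_fin fineK ?ge0_fin_numE//.
have -> : (2 * e)%:E = lebesgue_measure (`[u.2 - e, u.2 + e]%classic : set R).
  by rewrite lebesgue_measure_itv/= lte_fin ifT/= -?EFinD; [congr EFin; lra|lra].
apply: le_measure; rewrite ?inE//.
move=> y /=; rewrite in_itv/= => yu; split; rewrite /slice/=.
  by apply: Au; rewrite ltr_norml; lra.
by apply: Av; rewrite /= ltr_norml; lra.
Qed.

Lemma covariogram_meet (R : realType) (A : set (plane R)) (z : plane R) :
  covariogram A z != 0 -> exists2 u, A u & A (u - z).
Proof.
move=> g0; apply: contrapT => nA; move/eqP: g0; apply.
have S0 : A `&` translate A z = set0; last by rewrite /covariogram S0 /lambda2 measure0.
by rewrite translateE; apply/seteqP; split=> u //= -[Au Auz]; apply: nA; exists u.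
Qed.

Lemma difference_closed (R : realType) (K : set (plane R)) : compact K ->
  closed [set w | exists2 u, K u & K (u - w)].
Proof.
move=> cK; have cKK : compact (K `*` K) by exact: compact_setX.
pose f (p : plane R * plane R) : plane R := p.1 - p.2.
have cf : continuous f.
  move=> [u v] B /nbhs_plane[e e0 eB].
  have [e2 e20] : exists2 e2 : R, 0 < e2 & e2 + e2 = e by exists (e / 2); lra.
  move=> e2E.
  exists (ball u e2, ball v e2); first by split; exact: nbhsx_ballx.
  move=> [[u1 u2] [v1 v2]] [[/= h1 h2] [/= h3 h4]]; apply: eB.
    by move: h1 h3; rewrite /ball/= !ltr_norml; lra.
  by move: h2 h4; rewrite /ball/= !ltr_norml; lra.
have -> : [set w | exists2 u, K u & K (u - w)] = f @` (K `*` K).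
  apply/seteqP; split=> [w [u Ku Kw]|_ [[u v] [Ku Kv] <-]].
    by exists (u, u - w) => //; rewrite /f/= opprB addrC subrK.
  by exists u; rewrite // /f/= opprB addrC subrK.
apply: compact_closed => //; apply: continuous_compact => //.
exact: continuous_subspaceT.
Qed.

(** A difference of interior points of [A] has positive covariogram, hence is a difference of points
    of [K]. Interior points are dense in [A] and the difference set of [K] is closed. *)
Lemma difference_sub (R : realType) (A K : set (plane R)) :
  compact A -> regclosed A -> compact K -> covariogram A =1 covariogram K ->
  forall u v, A u -> A v -> exists2 u', K u' & K (u' - (u - v)).
Proof.
move=> cA rA cK gAK u v Au Av.
suff : closure [set w | exists2 u, K u & K (u - w)] (u - v).
  by rewrite -((closure_id _).1 (difference_closed cK)).
move=> B /nbhs_plane[e e0 eB].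
have e20 : 0 < e / 2 by lra.
have near w : A w -> exists2 w', A° w' & `|w'.1 - w.1 : R| < e / 2 /\ `|w'.2 - w.2 : R| < e / 2.
  rewrite -[in X in X -> _]rA => /(_ (ball w (e / 2))) []; first exact: nbhsx_ballx.
  move=> w' [Aw' [h1 h2]]; exists w' => //.
  by move: h1 h2; rewrite /ball/= ![`|w.1 - _|]distrC ![`|w.2 - _|]distrC.
have [u' Au' [u1 u2]] := near _ Au; have [v' Av' [v1 v2]] := near _ Av.
exists (u' - v'); split.
  apply: covariogram_meet; rewrite -gAK gt_eqF//; exact: covariogram_gt0.
rewrite [u' - v']surjective_pairing; apply: eB.
  by move: u1 v1; rewrite /= !ltr_norml; lra.
by move: u2 v2; rewrite /= !ltr_norml; lra.
Qed.

Lemma linear_max (R : realType) (A : set (plane R)) (p q : R) :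
  compact A -> A !=set0 ->
  exists2 u : plane R, A u & forall v : plane R, A v -> p * v.1 + q * v.2 <= p * u.1 + q * u.2.
Proof.
move=> cA [u0 Au0].
pose f (u : plane R) : R := p * u.1 + q * u.2.
have cf : continuous f.
  move=> u; apply: (@cvgD _ _ _ _ _ (fun u : plane R => p * u.1 : R^o) (fun u : plane R => q * u.2 : R^o)).
    by apply: (@cvgM _ _ _ _ (cst p) (fun u : plane R => u.1 : R^o)); [exact: cvg_cst|exact: cvg_fst].
  by apply: (@cvgM _ _ _ _ (cst q) (fun u : plane R => u.2 : R^o)); [exact: cvg_cst|exact: cvg_snd].
have cI : compact (f @` A) by apply: continuous_compact => //; exact: continuous_subspaceT.
have hs : has_sup (f @` A).
  split; first by exists (f u0), u0.
  have [N [_ NP]] := compact_bounded cI.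
  exists (`|N| + 1) => y fy; apply: le_trans (ler_norm _) _.
  by apply: (NP (`|N| + 1)) => //; rewrite ltr_pwDr// ler_norm.
have [u Au uE] : (f @` A) (sup (f @` A)) by apply: closed_sup => //; exact: compact_closed.
exists u => // v Av; rewrite -/(f u) -/(f v) uE; apply: ub_le_sup; first by case: hs.
by exists v.
Qed.

(** A point of [K] moved slightly towards the center of a box in [K] becomes interior: the box
    shrunk by the factor [s] surrounds it. *)
Lemma body_regclosed (R : realType) (K : set (plane R)) :
  convex_body K -> regclosed K.
Proof.
move=> hK; have [/convex_setP vK cK _] := hK.
have [c _ [e e0 eK]] := body_center hK.
apply/seteqP; split=> [u|u Ku].
  move=> /(closure_subset (@interior_subset _ K)).
  by rewrite -((closure_id _).1 (compact_closed _ cK)).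
move=> B /nbhs_plane[d d0 dB].
pose k : R := `|c.1 - u.1 : R| + `|c.2 - u.2 : R| + 1.
have k1 : 0 <= `|c.1 - u.1 : R| by [].
have k2 : 0 <= `|c.2 - u.2 : R| by [].
have k0 : 0 < k by rewrite /k; lra.
pose s := Num.min (1 / 2) (d / (2 * k)).
have s0 : 0 < s by rewrite lt_min !divr_gt0// mulr_gt0.
have [s1 sd] : s <= 1 / 2 /\ s <= d / (2 * k) by rewrite /s !ge_min !lexx orbT.
have skd : s * k < d.
  by move: sd; rewrite ler_pdivlMr ?mulr_gt0//; lra.
exists (seg u c s); split.
  apply/nbhs_plane; exists (s * e); first by rewrite mulr_gt0.
  move=> x y hx hy; pose x' := c.1 + (x - (seg u c s).1) / s.
  pose y' := c.2 + (y - (seg u c s).2) / s.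
  have -> : (x, y) = seg u (x', y') s.
    have sn : s != 0 by rewrite gt_eqF.
    by apply/pair_equal_spec; rewrite /x' /y' /seg/=; split; field.
  apply: vK => //; last by lra.
  apply: eK; rewrite /x' /y' addrAC subrr add0r normrM normfV (gtr0_norm s0)
    ler_pdivrMr// mulrC ltW//.
apply: dB; rewrite /seg/= addrAC subrr add0r normrM gtr0_norm//.
  by apply: le_lt_trans skd; rewrite ler_wpM2l ?ltW// /k; lra.
by apply: le_lt_trans skd; rewrite ler_wpM2l ?ltW// /k; lra.
Qed.

Section faces.
Variable R : realType.
Implicit Types A K : set (plane R).

(** [A] meets the line at infinitely many abscissas. A face of [A] is not known to be a segment, and
    this form provides a point off any exceptional list. *)
Definition wide_face A (a m : R) :=
  forall N : seq R, exists2 x, x \notin N & A (x, a * x + m).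
Definition maxval A (a m : R) :=
  (exists x, A (x, a * x + m)) /\ forall x y, A (x, y) -> y - a * x <= m.
Definition minval A (a m : R) :=
  (exists x, A (x, a * x + m)) /\ forall x y, A (x, y) -> m <= y - a * x.
Definition difference A (w : plane R) := exists2 u, A u & A (u - w).

Lemma vals_exist A (a : R) : compact A -> A !=set0 ->
  (exists m, maxval A a m) /\ (exists n, minval A a n).
Proof.
move=> cA A0; split.
  have [u Au umax] := linear_max (- a) 1 cA A0.
  exists (u.2 - a * u.1); split.
    by exists u.1; rewrite subrKC -surjective_pairing.
  by move=> x y /umax /=; lra.
have [u Au umax] := linear_max a (- 1) cA A0.
exists (u.2 - a * u.1); split.
  by exists u.1; rewrite subrKC -surjective_pairing.
by move=> x y /umax /=; lra.
Qed.

Lemma difference_le A K (a m n m' n' : R) :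
  (forall w, difference A w -> difference K w) ->
  maxval A a m -> minval A a n -> maxval K a m' -> minval K a n' -> m - n <= m' - n'.
Proof.
move=> AK [[x Ax] _] [[x' Ax'] _] [_ Km] [_ Kn].
have [|[u1 u2] Ku Kuw] := AK ((x, a * x + m) - (x', a * x' + n)).
  by exists (x, a * x + m) => //; rewrite opprB addrC subrK.
by move: (Km _ _ Ku) (Kn _ _ Kuw) => /=; lra.
Qed.

(** Equal difference sets give equal widths [m - n] and [m' - n']. A flat face of [K] yields an
    interval of differences realizing the width, and each is a difference of a top point and a
    bottom point of [A]; two finite faces would provide only finitely many. *)
Lemma wide_face_or A K (a m n m' n' : R) :
  (forall w, difference A w <-> difference K w) -> convex_set K ->
  maxval A a m -> minval A a n -> maxval K a m' -> minval K a n' ->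
  flat_bottom K a \/ flat_top K a -> wide_face A a m \/ wide_face A a n.
Proof.
move=> AK /convex_setP vK mA nA mK nK flat.
have E : m - n = m' - n'.
  apply/eqP; rewrite eq_le (@difference_le A K a m n m' n')//=; last by move=> w /AK.
  by apply: (@difference_le K A a m' n' m n) => // w /AK.
have sub (x1 x2 c s : R) : x1 < s < x2 -> K (x1, a * x1 + c) -> K (x2, a * x2 + c) ->
    K (s, a * s + c).
  move=> xs K1 K2; have p : x2 - x1 != 0 by apply/eqP; lra.
  have p0 : 0 < x2 - x1 by lra.
  have := vK _ _ ((s - x1) / (x2 - x1)) K1 K2; rewrite /seg/=.
  have -> : a * x1 + c + (s - x1) / (x2 - x1) * (a * x2 + c - (a * x1 + c)) = a * s + c.
    by field.
  rewrite divfK// subrKC; apply.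
  by rewrite ler_pdivlMr// ler_pdivrMr// mul0r mul1r; lra.
have [p [q [pq dK]]] : exists p q, p < q /\ forall s, p < s < q ->
    difference K (s, a * s + (m' - n')).
  case: flat => -[c [x1 [x2 [x12 K1 K2 Kc]]]].
  - have [[x3 K3] Km] := mK; have [[x4 K4] Kn] := nK.
    have cE : c = n' by have := Kc _ _ K4; have := Kn _ _ K1; lra.
    exists (x3 - x2), (x3 - x1); split; first by lra.
    move=> s hs; exists (x3, a * x3 + m') => //.
    have := sub x1 x2 c (x3 - s) ltac:(lra) K1 K2; rewrite cE.
    by congr (K (_, _)) => /=; ring.
  - have [[x3 K3] Km] := mK; have [[x4 K4] Kn] := nK.
    have cE : c = m' by have := Kc _ _ K3; have := Km _ _ K1; lra.
    exists (x1 - x4), (x2 - x4); split; first by lra.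
    move=> s hs; exists (x4 + s, a * (x4 + s) + m').
      by rewrite -cE; apply: (sub x1 x2) => //; lra.
    by move: K4; congr (K (_, _)) => /=; ring.
apply: contrapT => /not_orP[nm nn].
have [N1 HN1] : exists N : seq R, forall x, A (x, a * x + m) -> x \in N.
  apply: contrapT => h; apply: nm => N; apply: contrapT => h'; apply: h; exists N => x Ax.
  by apply: contrapT => /negP xN; apply: h'; exists x.
have [N2 HN2] : exists N : seq R, forall x, A (x, a * x + n) -> x \in N.
  apply: contrapT => h; apply: nn => N; apply: contrapT => h'; apply: h; exists N => x Ax.
  by apply: contrapT => /negP xN; apply: h'; exists x.
have [s hs sN] := avoid_seq [seq x - y | x <- N1, y <- N2] pq.
have /AK[[u1 u2] Au Auw] := dK s hs.
have [_ Am] := mA; have [_ An] := nA.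
have u2E : u2 = a * u1 + m by move: (Am _ _ Au) (An _ _ Auw) => /=; lra.
move/negP: sN; apply; apply/allpairsP; exists (u1, u1 - s) => /=; split.
- by apply: HN1; rewrite -u2E.
- apply: HN2; move: Auw; congr (A (_, _)); rewrite /= u2E; move: E; lra.
- by ring.
Qed.

End faces.

Lemma jump_mem (R : realType) (S : set R) (b : R) : closed S -> jump S b != 0 -> S b.
Proof.
move=> cS jS; have [side|side] : rside S b \/ lside S b.
- by apply: contrapT => /not_orP[r l]; move: jS; rewrite /jump !asboolF// subrr eqxx.
- case: side => d d0 dS; rewrite [S]((closure_id _).1 cS) => B /nbhs_ballP[e /= e0 eB].
  pose m := Num.min d e / 2.
  have [m0 [md me]] : 0 < m /\ m < d /\ m < e.
    have h0 : 0 < Num.min d e by rewrite lt_min d0.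
    have h1 : Num.min d e <= d by rewrite ge_min lexx.
    have h2 : Num.min d e <= e by rewrite ge_min lexx orbT.
    by rewrite /m; lra.
  exists (b + m); split; first by apply: dS; rewrite m0.
  by apply: eB; rewrite /ball/= opprD addrA subrr add0r normrN ger0_norm; lra.
- case: side => d d0 dS; rewrite [S]((closure_id _).1 cS) => B /nbhs_ballP[e /= e0 eB].
  pose m := Num.min d e / 2.
  have [m0 [md me]] : 0 < m /\ m < d /\ m < e.
    have h0 : 0 < Num.min d e by rewrite lt_min d0.
    have h1 : Num.min d e <= d by rewrite ge_min lexx.
    have h2 : Num.min d e <= e by rewrite ge_min lexx orbT.
    by rewrite /m; lra.
  exists (b - m); split; first by apply: dS; rewrite m0.
  by apply: eB; rewrite /ball/= opprD addrA subrr add0r opprK ger0_norm; lra.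
Qed.

(** The vector [z] moves the bottom face so that it overlaps the top face. As it crosses the whole
    width, ends of the same kind never coincide, so the kink is nowhere positive off finitely many
    abscissas and is -1 on the overlap. *)
Lemma body_kink_opposite (R : realType) (K : set (plane R)) (a m n : R) :
  convex_body K -> maxval K a m -> minval K a n -> flat_bottom K a -> flat_top K a ->
  exists2 z : plane R, z.2 = a * z.1 + (m - n) &
  \int[@lebesgue_measure R]_x kink K [:: xmin K; xmax K] (body_cuts K) z x < 0.
Proof.
move=> hK mK nK [n' [x1 [x2 [x12 K1 K2 Kn]]]] [m' [y1 [y2 [y12 L1 L2 Km]]]].
have [/convex_setP vK _ _] := hK.
have nE : n' = n.
  by have [[w Kw] Kn'] := nK; have := Kn _ _ Kw; have := Kn' _ _ K1; lra.
have mE : m' = m.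
  by have [[w Kw] Km'] := mK; have := Km _ _ Kw; have := Km' _ _ L1; lra.
subst n' m'.
have sub (p1 p2 c s : R) : p1 < s < p2 -> K (p1, a * p1 + c) -> K (p2, a * p2 + c) ->
    K (s, a * s + c).
  move=> xs M1 M2; have p : p2 - p1 != 0 by apply/eqP; lra.
  have p0 : 0 < p2 - p1 by lra.
  have := vK _ _ ((s - p1) / (p2 - p1)) M1 M2; rewrite /seg/=.
  have -> : a * p1 + c + (s - p1) / (p2 - p1) * (a * p2 + c - (a * p1 + c)) = a * s + c.
    by field.
  rewrite divfK// subrKC; apply.
  by rewrite ler_pdivlMr// ler_pdivrMr// mul0r mul1r; lra.
(* The left end of the given bottom segment goes to the left end of the top one. *)
pose z : plane R := (y1 - x1, a * (y1 - x1) + (m - n)).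
exists z => //.
pose d := Num.min (x2 - x1) (y2 - y1).
have d0 : 0 < d by rewrite lt_min; lra.
have [dx dy] : d <= x2 - x1 /\ d <= y2 - y1 by rewrite /d !ge_min !lexx orbT.
have bs := body_sliced hK.
have [i1 _] := kink_cvg z bs.
have i2 := integrable_indic_itv y1 (y1 + d) false true.
apply: (@le_lt_trans _ _ (\int[@lebesgue_measure R]_x (- 1 * \1_`]y1, y1 + d[%classic x))); last first.
  rewrite RintegralZl// Rintegral_indic//= lebesgue_measure_itv/= lte_fin ifT/=; lra.
pose N0 := [:: xmin K; xmax K].
apply: (le_Rintegral_finite (N := N0 ++ [seq n + z.1 | n <- N0])) => //; last first.
  exact: (integrableZl measurableT (- 1) i2).
move=> x; rewrite mem_cat negb_or => /andP[xN xzN].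
have {}xzN : x - z.1 \notin N0.
  by apply: contra xzN => h; apply/mapP; exists (x - z.1); rewrite // subrK.
rewrite body_kink//.
have bds w : dom K w -> [/\ K (w, lo K w), K (w, hi K w), lo K w < hi K w,
    hi K w - a * w <= m & n <= lo K w - a * w].
  move=> Dw; have [k1 k2 h] := dom_slice hK Dw; split=> //; first exact: Km.
  exact: Kn.
have [xd|xd] := boolP (x \in `]y1, y1 + d[%classic); last first.
  rewrite indicE (negbTE xd) mulr0; case: ifP => // /andP[Dx Dxz].
  have [_ _ h1 h2 h3] := bds _ Dx; have [_ _ h4 h5 h6] := bds _ Dxz.
  rewrite (_ : lo K x - _ == lo K _ = false); last first.
    by apply/eqP => E; move: h1 h2 h3 h4 h5 h6 E; rewrite /z/=; lra.
  rewrite (_ : hi K x - _ == hi K _ = false); last first.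
    by apply/eqP => E; move: h1 h2 h3 h4 h5 h6 E; rewrite /z/=; lra.
  by rewrite mulr0n sub0r subr0 -opprD oppr_le0 addr_ge0// ler0n.
rewrite indicE xd mulr1; move: xd; rewrite inE/= in_itv/= => xd.
have Kt : K (x, a * x + m) by apply: (sub y1 y2) => //; lra.
have Kb : K (x - z.1, a * (x - z.1) + n) by apply: (sub x1 x2) => //; rewrite /z/=; lra.
have Dx : dom K x.
  have [_ _ _ _ h1] := slice_bounds hK L1; have [_ _ _ _ h2] := slice_bounds hK L2.
  by move: h1 h2; rewrite /dom /oint; lra.
have Dxz : dom K (x - z.1).
  have [_ _ _ _ h1] := slice_bounds hK K1; have [_ _ _ _ h2] := slice_bounds hK K2.
  by move: h1 h2; rewrite /dom /oint /z/=; lra.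
have [_ _ h1 h2 h3] := bds _ Dx; have [_ _ h4 h5 h6] := bds _ Dxz.
have [_ _ _ h7 _] := slice_bounds hK Kt; have [_ _ h8 _ _] := slice_bounds hK Kb.
rewrite Dx Dxz/=.
rewrite (_ : lo K x - _ == lo K _ = false); last first.
  by apply/eqP => E; move: h1 h2 h3 h4 h5 h6 h7 h8 E; rewrite /z/=; lra.
rewrite (_ : hi K x - _ == hi K _ = false); last first.
  by apply/eqP => E; move: h1 h2 h3 h4 h5 h6 h7 h8 E; rewrite /z/=; lra.
rewrite (_ : lo K x - _ == hi K _ = false); last first.
  by apply/eqP => E; move: h1 h2 h3 h4 h5 h6 h7 h8 E; rewrite /z/=; lra.
rewrite (_ : hi K x - _ == lo K _ = true); last first.
  by apply/eqP; move: h1 h2 h3 h4 h5 h6 h7 h8; rewrite /z/=; lra.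
by rewrite mulr0n mulr1n; lra.
Qed.

(** * Lines that carry boundary support the set *)

Section essential.
Variable R : realType.
Implicit Types A K : set (plane R).

(** A nonzero kink at [x] needs a top point of [A] above [x] and a bottom point above [x - z.1]. If
    either face had finitely many points, the kink would vanish off a finite set. *)
Lemma lined_kink_opposite A V L (a m n : R) (z : plane R) :
  lined A V L -> maxval A a m -> minval A a n -> z.2 = a * z.1 + (m - n) ->
  \int[@lebesgue_measure R]_x kink A (breaks V L) (cuts L) z x != 0 ->
  wide_face A a m /\ wide_face A a n.
Proof.
move=> Al [_ Am] [_ An] zE I0; have [cA _ _ _] := Al.
have clS x : closed (slice A x) by apply: slice_closed; exact: compact_closed.
have [i1 _] := kink_cvg z (lined_sliced Al).
have kn0 x : kink A (breaks V L) (cuts L) z x != 0 ->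
    A (x, a * x + m) /\ A (x - z.1, a * (x - z.1) + n).
  rewrite /kink; case: ifP => _; first by rewrite eqxx.
  move=> s0; have [b j0] : exists b, jump (slice A x) b * jump (slice A (x - z.1)) (b - z.2) != 0.
    apply: contrapT => h; move/eqP: s0; apply; apply: big1 => b _.
    by apply: contrapT => /eqP hb; apply: h; exists b.
  move: j0; rewrite mulf_eq0 negb_or => /andP[/(jump_mem (clS _)) Ab /(jump_mem (clS _)) Abz].
  have bE : b = a * x + m by have := Am _ _ Ab; have := An _ _ Abz; rewrite zE; lra.
  split; first by rewrite -bE.
  by move: Abz; congr (A (_, _)); rewrite bE zE; ring.
have I0' (N : seq R) : (forall x, x \notin N -> kink A (breaks V L) (cuts L) z x = 0) -> False.
  move=> kN; move/eqP: I0; apply.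
  rewrite (@Rintegral_finite_eq _ N _ (cst 0)).
  - by rewrite Rintegral_cst// mul0r.
  - exact: kN.
  - by apply/measurable_EFinP; exact: (measurable_int (@lebesgue_measure R)).
  - exact: measurable_cst.
split=> N; apply: contrapT => h.
  apply: (I0' N) => x xN; apply: contrapT => /eqP /kn0[Ax _]; apply: h.
  by exists x.
apply: (I0' [seq n + z.1 | n <- N]) => x xN; apply: contrapT => /eqP /kn0[_ Ax]; apply: h.
exists (x - z.1) => //; apply: contra xN => h; apply/mapP; exists (x - z.1) => //.
by rewrite subrK.
Qed.

(** By regularity interior points accumulate at the given point. One of them, off [l], lies in a
    cell adjacent to [l] above [x], and [lined_cell] carries it to the slice above [x]. *)
Lemma lined_side A V L (l : R * R) (x : R) : lined A V L -> l \in L ->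
  x \notin breaks V L -> A (x, line l x) ->
  rside (slice A x) (line l x) \/ lside (slice A x) (line l x).
Proof.
move=> Al lL xN Ax; have [cA rA uL AL] := Al.
have [_ /(_ x xN)[_ _ S]] := lined_sliced Al.
have [d d0 dN] := seq_gap (breaks V L) x.
have [g g0 gL] := seq_gap (cuts L x) (line l x).
have [e e0 eS] := stepset_sides (line l x) S.
pose M : R := 1 + \sum_(k <- L) `|k.1|.
have sM k : k \in L -> `|k.1| <= M.
  move=> kL; rewrite /M (big_rem k)//= addrCA lerDl.
  by rewrite addr_ge0// sumr_ge0.
have M0 : 0 < M by rewrite ltr_pwDl// sumr_ge0.
(* Within [r] of [x] there is no break, and every line drifts by at most half the gap [g] between
   [l] and the other lines above [x]. *)
pose r := Num.min (Num.min d (g / 2)) (g / 2 / M).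
have r0 : 0 < r by rewrite !lt_min d0 !divr_gt0.
have [rd rg rM] : [/\ r <= d, r <= g / 2 & r * M <= g / 2].
  split; rewrite -?ler_pdivlMr// /r !ge_min ?lexx ?orbT//.
pose f := Num.min e g / 2.
have [f0 fe fg] : [/\ 0 < f, f < e & f < g].
  have h0 : 0 < Num.min e g by rewrite lt_min e0.
  have h1 : Num.min e g <= e by rewrite ge_min lexx.
  have h2 : Num.min e g <= g by rewrite ge_min lexx orbT.
  by rewrite /f; split; lra.
have [u Au [u1 u2 ul]] : exists2 u : plane R, A u &
    [/\ `|u.1 - x : R| < r, `|u.2 - line l x : R| < r & (u.2 : R) != line l u.1].
  have : closure A° (x, line l x) by rewrite rA.
  move=> /(_ (ball ((x, line l x) : plane R) r)) []; first exact: nbhsx_ballx.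
  move=> w [/nbhs_plane[e' e'0 eA] [h1 h2]].
  have {}h1 : `|w.1 - x : R| < r by rewrite distrC.
  have {}h2 : `|w.2 - line l x : R| < r by rewrite distrC.
  (* An interior point lying on [l] is pushed up by a small [s]. *)
  have [wl|wl] := eqVneq (w.2 : R) (line l w.1); last first.
    exists w => //; rewrite [w]surjective_pairing.
    by apply: eA; rewrite subrr normr0.
  have pos : 0 < Num.min e' (r - `|w.2 - line l x : R|) by rewrite lt_min e'0 subr_gt0.
  have [s s1 s2] := avoid_seq [::] pos.
  have [s0] := andP s1; rewrite lt_min => /andP[se sr].
  exists (w.1, (w.2 : R) + s).
    by apply: eA; rewrite ?subrr ?normr0// addrAC subrr add0r gtr0_norm.
  split=> //=; last by rewrite wl; apply/eqP; lra.
  rewrite addrAC; apply: le_lt_trans (ler_normD _ _) _.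
  by rewrite (gtr0_norm s0); lra.
have nN n : n \in breaks V L -> ~~ (x <= n <= u.1) /\ ~~ (u.1 <= n <= x).
  move=> nN; have xn : n != x by apply: contraNneq xN => <-.
  have := dN _ nN xn; rewrite ler_normr => h.
  by move: u1; rewrite ltr_norml => u1; split; apply/negP => h'; lra.
have far k : k \in L -> k != l ->
    (line k x <= line l x - g /\ line k u.1 < u.2) \/
    (line l x + g <= line k x /\ (u.2 : R) < line k u.1).
  move=> kL kl; have kx : line k x != line l x by apply: contra_neq kl => /(line_inj kL lL xN).
  have := gL _ (map_f (fun l => line l x) kL) kx.
  have kr : `|k.1 * (u.1 - x)| <= g / 2.
    rewrite normrM; apply: le_trans rM; rewrite mulrC.
    by apply: ler_pM => //; [exact: ltW | exact: sM].
  have kE : line k u.1 = line k x + k.1 * (u.1 - x) by rewrite /line; ring.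
  move: u2 kr; rewrite kE ltr_norml ler_norml ler_normr; lra.
have cell s : (s = f /\ line l u.1 < u.2) \/ (s = - f /\ (u.2 : R) < line l u.1) ->
    A (x, line l x + s).
  move=> sf; have lines k : k \in L ->
      (line k x < line l x + s /\ line k u.1 < u.2) \/
      (line l x + s < line k x /\ (u.2 : R) < line k u.1).
    move=> kL; have [->|kl] := eqVneq k l.
      by case: sf => -[-> h]; [left|right]; split=> //; lra.
    by have := far k kL kl; case: sf => -[-> _]; lra.
  have Au' : A (u.1, u.2) by rewrite -surjective_pairing.
  have [xu|ux] := leP x u.1.
    by apply/(lined_cell Al xu _ lines) => // n /nN[].
  apply/(lined_cell Al (ltW ux)); last exact: Au'.
    by move=> n /nN[].
  by move=> k /lines; tauto.
have [Sr Sl] := eS f ltac:(rewrite f0; exact: fe).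
move: ul; rewrite neq_lt => /orP[h|h].
  by right; apply/Sl; apply: (cell (- f)); right.
by left; apply/Sr; apply: (cell f); left.
Qed.

(** On a supporting line one side is empty; [lined_side] says that the other is not, so the jump is
    1 or -1. *)
Lemma wide_face_essential A V L (l : R * R) : lined A V L -> l \in L ->
  (forall x y, A (x, y) -> y - l.1 * x <= l.2) \/
  (forall x y, A (x, y) -> l.2 <= y - l.1 * x) ->
  wide_face A l.1 l.2 -> exists2 x, x \notin breaks V L & ljump A l x != 0.
Proof.
move=> Al lL ext wide; have [x xN Ax] := wide (breaks V L).
exists x => //; have := lined_side Al lL xN Ax; rewrite /ljump /jump.
case: ext => ext.
  have nr : ~ rside (slice A x) (line l x).
    move=> [d d0 /(_ (d / 2))]; rewrite /slice/= => /(_ ltac:(lra)) /ext.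
    by rewrite /line; lra.
  by case=> // h; rewrite asboolF// asboolT// sub0r oppr_eq0 oner_eq0.
have nl : ~ lside (slice A x) (line l x).
  move=> [d d0 /(_ (d / 2))]; rewrite /slice/= => /(_ ltac:(lra)) /ext.
  by rewrite /line; lra.
by case=> // h; rewrite asboolT// asboolF// subr0 oner_eq0.
Qed.

Lemma lined_cons A V L (l : R * R) : lined A V L -> l \notin L -> lined A V (l :: L).
Proof.
move=> [cA rA uL AL] lL; split=> //; first by rewrite /= lL.
move=> x y Axy nA; have [?|[k kL yk]] := AL _ _ Axy nA; [by left|right].
by exists k; rewrite // inE kL orbT.
Qed.

Lemma lined_extend A V L (l0 l1 : R * R) : lined A V L ->
  exists L', [/\ lined A V L', {subset L <= L'}, l0 \in L' & l1 \in L'].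
Proof.
have one L0 l : lined A V L0 -> exists L', [/\ lined A V L', {subset L0 <= L'} & l \in L'].
  move=> Al; have [lL|lL] := boolP (l \in L0); first by exists L0; split.
  exists (l :: L0); split; [exact: lined_cons| |by rewrite inE eqxx].
  by move=> k kL; rewrite inE kL orbT.
move=> /(one _ l0)[L' [Al' LL' l0L']].
have [L'' [Al'' LL'' l1L'']] := one _ l1 Al'.
by exists L''; split=> // [k /LL'/LL''//|]; exact: LL''.
Qed.

Lemma essential_supporting A K V L (l : R * R) (x0 : R) :
  lined A V L -> convex_body K -> covariogram A =1 covariogram K ->
  l \in L -> x0 \notin breaks V L -> ljump A l x0 != 0 ->
  (forall x y, A (x, y) -> y - l.1 * x <= l.2) \/
  (forall x y, A (x, y) -> l.2 <= y - l.1 * x).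
Proof.
move=> Al hK gAK lL x0N jx0; have [cA rA uL AL] := Al.
have [vK cK _] := hK.
have Ax0 : A (x0, line l x0).
  by apply: (jump_mem (slice_closed (x := x0) (compact_closed _ cA))) => //; exact: norm_hausdorff.
have A0 : A !=set0 by exists (x0, line l x0).
have K0 : K !=set0.
  have [_ _ [u Ku]] := hK; exists u; exact: interior_subset Ku.
pose a := l.1.
have [[m mA] [n nA]] := vals_exist a cA A0.
have [[m' mK] [n' nK]] := vals_exist a cK K0.
have [_ Am] := mA; have [_ An] := nA.
have [lm|lm] := eqVneq l.2 m; first by left => x y /Am; rewrite lm.
have [ln|ln] := eqVneq l.2 n; first by right => x y /An; rewrite ln.
exfalso.
have ltm : l.2 < m by rewrite lt_neqAle lm /=; have := Am _ _ Ax0; rewrite /line /a; lra.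
have ltn : n < l.2 by rewrite lt_neqAle eq_sym ln /=; have := An _ _ Ax0; rewrite /line /a; lra.
have dAK w : difference A w <-> difference K w.
  have wE (u : plane R) : u - (u - w) = w by rewrite opprB addrC subrK.
  split=> -[u Au Auw].
    have [u' Ku' Kw] := difference_sub cA rA cK gAK Au Auw.
    by exists u' => //; rewrite wE in Kw.
  have [u' Ku' Kw] := difference_sub cK (body_regclosed hK) cA (fsym gAK) Au Auw.
  by exists u' => //; rewrite wE in Kw.
have [L' [Al' LL' mL nL]] := lined_extend (a, m) (a, n) Al.
have sliceK := body_sliced hK.
(* The added lines create new breaks, possibly at [x0]; a nearby abscissa shows the same jump. *)
have [x1 x1N jx1] : exists2 x1, x1 \notin breaks V L' & ljump A l x1 != 0.
  have [d d0 dN] := seq_gap (breaks V L) x0.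
  have pos : x0 < x0 + d by lra.
  have [x1 hx1 x1N] := avoid_seq (breaks V L') pos.
  exists x1 => //; rewrite -(ljump_const Al lL (x := x0))//; first by lra.
  move=> k kN; apply/negP => hk; have kx : k != x0 by apply: contraNneq x0N => <-.
  by have := dN _ kN kx; rewrite ger0_norm; lra.
have ess c : (a, c) \in L' -> (forall x y, A (x, y) -> y - a * x <= c) \/
    (forall x y, A (x, y) -> c <= y - a * x) -> wide_face A a c ->
    [/\ (a, c) \in L', (a, c).1 = a & exists2 x, x \notin breaks V L' & ljump A (a, c) x != 0].
  move=> cL ext wide; split=> //.
  exact: (wide_face_essential Al' cL ext wide).
have essl : [/\ l \in L', l.1 = a & exists2 x, x \notin breaks V L' & ljump A l x != 0].
  by split=> //; [exact: LL' | exists x1].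
have wide_or := wide_face_or dAK vK mA nA mK nK.
have wide_and : flat_bottom K a -> flat_top K a -> wide_face A a m /\ wide_face A a n.
  move=> fb ft; have [z zE Iz] := body_kink_opposite hK mK nK fb ft.
  have E : m - n = m' - n'.
    apply/eqP; rewrite eq_le (@difference_le _ A K a m n m' n')//=; last by move=> w /dAK.
    by apply: (@difference_le _ K A a m' n' m n) => // w /dAK.
  apply: (lined_kink_opposite Al' mA nA (z := z)); first by rewrite E.
  by rewrite (kink_integral_eq z (lined_sliced Al') sliceK gAK) lt_eqF.
(* [l] together with the wide faces of [A] forced by the flat faces of [K]: one line more than [K]
   has flat faces of slope [a]. *)
have [E uE [EL szE]] : exists2 E : seq (R * R), uniq E & (forall k, k \in E ->
    [/\ k \in L', k.1 = a & exists2 x, x \notin breaks V L' & ljump A k x != 0]) /\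
    (`[<flat_bottom K a>])%:R + (`[<flat_top K a>])%:R < (size E)%:R :> R.
  have lmE : l != (a, m) by apply/eqP => h; move: ltm; rewrite h /= ltxx.
  have lnE : l != (a, n) by apply/eqP => h; move: ltn; rewrite h /= ltxx.
  have mnE : (a, m) != (a, n) by apply/eqP => -[h]; move: ltm ltn; rewrite h; lra.
  have [fb|nfb] := pselect (flat_bottom K a); have [ft|nft] := pselect (flat_top K a).
  - have [wm wn] := wide_and fb ft.
    exists [:: l; (a, m); (a, n)]; first by rewrite /= !inE negb_or lmE lnE mnE.
    split=> [k|]; last by rewrite !asboolT//= -natrD ltr_nat.
    rewrite !inE => /or3P[] /eqP->//; first by apply: ess => //; left.
    by apply: ess => //; right.
  - have szE c : l != (a, c) ->  (`[<flat_bottom K a>])%:R + (`[<flat_top K a>])%:R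
        < (size [:: l; (a, c)])%:R :> R.
      by rewrite asboolT// asboolF//= addr0 ltr_nat.
    have [w|w] := wide_or (or_introl fb).
      exists [:: l; (a, m)]; [by rewrite /= inE lmE | split; last exact: szE].
      by move=> k; rewrite !inE => /orP[] /eqP->//; apply: ess => //; left.
    exists [:: l; (a, n)]; [by rewrite /= inE lnE | split; last exact: szE].
    by move=> k; rewrite !inE => /orP[] /eqP->//; apply: ess => //; right.
  - have szE c : l != (a, c) ->  (`[<flat_bottom K a>])%:R + (`[<flat_top K a>])%:R
        < (size [:: l; (a, c)])%:R :> R.
      by rewrite asboolF// asboolT//= add0r ltr_nat.
    have [w|w] := wide_or (or_intror ft).
      exists [:: l; (a, m)]; [by rewrite /= inE lmE | split; last exact: szE].
      by move=> k; rewrite !inE => /orP[] /eqP->//; apply: ess => //; left.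
    exists [:: l; (a, n)]; [by rewrite /= inE lnE | split; last exact: szE].
    by move=> k; rewrite !inE => /orP[] /eqP->//; apply: ess => //; right.
  - exists [:: l] => //; split=> [k|]; last by rewrite !asboolF//= addr0 ltr_nat.
    by rewrite inE => /eqP->.
have [t1 t10 lower] := lined_lower Al' uE EL.
have [t2 t20 upper] := body_upper a hK.
have pos : 0 < Num.min t1 t2 by rewrite lt_min t10.
have [t ht _] := avoid_seq [::] pos.
have [tp] := andP ht; rewrite lt_min => /andP[tt1 tt2].
have := lower t ltac:(rewrite tp; exact: tt1).
have := upper t ltac:(rewrite tp; exact: tt2).
rewrite !(kink_integral_eq _ (lined_sliced Al') sliceK gAK) => u1 u2.
have := le_trans u2 u1; rewrite ler_pM2l// => h.
by move: szE; rewrite ltNge h.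
Qed.

End essential.

(** * Exchange of the coordinates and conclusion *)

Definition transpose (R : realType) (A : set (plane R)) : set (plane R) :=
  [set u | A (u.2, u.1)].

Lemma transposeK (R : realType) (A : set (plane R)) : transpose (transpose A) = A.
Proof. by apply/seteqP; split=> -[x y]. Qed.

(** The image of the product measure under the exchange agrees with it on rectangles, which
    determine it. *)
Lemma lambda2_transpose (R : realType) (S : set (plane R)) :
  measurable (S : set (measurableTypeR R * measurableTypeR R)) ->
  lambda2 (transpose S) = lambda2 S.
Proof.
move=> mS.
pose sw : measurableTypeR R * measurableTypeR R -> measurableTypeR R * measurableTypeR R :=
  fun u => (u.2, u.1).
have msw : measurable_fun setT sw by exact: measurable_swap.
rewrite /lambda2.
have := @product_measure_unique _ _ _ _ R lebesgue_measure lebesgue_measure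
  (pushforward (lebesgue_measure \x lebesgue_measure)%E sw).
move=> H; rewrite [RHS](H msw _ S mS) /pushforward//.
move=> X Y mX mY.
have E : sw @^-1` (X `*` Y) = Y `*` X by apply/seteqP; split=> -[x y] [].
by rewrite muleC -product_measure1E// -E.
Qed.

Lemma transpose_compact (R : realType) (A : set (plane R)) :
  compact A -> compact (transpose A).
Proof.
move=> cA.
have -> : transpose A = (fun u : plane R => (u.2, u.1) : plane R) @` A.
  apply/seteqP; split=> [[x y] Axy|_ [[x y] Axy <-]//]; by exists (y, x).
apply: continuous_compact => //; apply: continuous_subspaceT.
move=> [x y] B /nbhs_plane[e e0 eB]; apply/nbhs_plane; exists e => // x' y' hx hy.
exact: eB.
Qed.

Lemma transpose_nbhs (R : realType) (A : set (plane R)) (u : plane R) :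
  nbhs (u.2, u.1) A -> nbhs u (transpose A).
Proof.
move=> /nbhs_plane[e e0 eA]; apply/nbhs_plane; exists e => // x y hx hy.
exact: eA.
Qed.

Lemma transpose_interior (R : realType) (A : set (plane R)) :
  (transpose A)° = transpose A°.
Proof.
apply/seteqP; split=> -[x y] /=; last exact: transpose_nbhs.
by move=> /(@transpose_nbhs _ (transpose A) (y, x)); rewrite transposeK.
Qed.

Lemma transpose_regclosed (R : realType) (A : set (plane R)) :
  regclosed A -> regclosed (transpose A).
Proof.
move=> rA; rewrite /regclosed transpose_interior.
have H (B : set (plane R)) : transpose (closure B) `<=` closure (transpose B).
  move=> [x y] cB U /(@transpose_nbhs _ U (y, x)) /cB[[x' y'] [B' U']].
  by exists (y', x').
apply/seteqP; split=> [[x y] h|[x y]].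
  have : transpose (closure (transpose A°)) (y, x) by [].
  by move=> /H; rewrite transposeK rA.
by rewrite -[X in transpose X _ -> _]rA => /H.
Qed.

Lemma transpose_body (R : realType) (K : set (plane R)) :
  convex_body K -> convex_body (transpose K).
Proof.
move=> [/convex_setP vK cK [[x y] Ku]]; split.
- apply/convex_setP => u v s Ku' Kv' s01.
  exact: (vK (u.2, u.1) (v.2, v.1) s Ku' Kv' s01).
- exact: transpose_compact.
- by exists (y, x); rewrite transpose_interior.
Qed.

Lemma covariogram_transpose (R : realType) (A : set (plane R)) (z : plane R) :
  compact A -> covariogram (transpose A) z = covariogram A (z.2, z.1).
Proof.
move=> cA; rewrite /covariogram -[in RHS]lambda2_transpose.
  congr (fine (lambda2 _)); rewrite !translateE; apply/seteqP.
  by split=> -[x y].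
apply: measurableI; first exact: compact_measurable2.
apply: compact_measurable2; apply: (continuous_compact _ cA).
apply: continuous_subspaceT; exact: continuous_translation.
Qed.

(** * Filling a box in which slices have no jump *)

Lemma reflect_jump (R : realType) (S : set R) (b : R) :
  jump [set y | S (- y)] b = - jump S (- b).
Proof.
rewrite /jump opprB; congr (_%:R - _%:R); congr nat_of_bool; apply: asbool_equiv_eq;
  split=> -[d d0 dS]; exists d => // e /dS /=; by rewrite ?opprD ?opprK.
Qed.

(** Let [t] be the supremum of the points up to which [S] is filled. It is in [S] by closedness, and
    a zero jump at [t] turns the left germ into a right germ, so the filling cannot stop before
    [y]. *)
Lemma fill_right (R : realType) (S : set R) (C D y1 y2 y : R) : closed S ->
  (forall b, C < b < D -> jump S b = 0) -> C <= y1 -> y1 < y2 ->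
  (forall z, y1 < z < y2 -> S z) -> y1 < y < D -> S y.
Proof.
move=> cS jS Cy1 y12 S12 yD.
have lim t : y1 < t -> (forall z, y1 < z < t -> S z) -> S t.
  move=> yt St; rewrite [S]((closure_id _).1 cS) => B /nbhs_ballP[e /= e0 eB].
  have pos : Num.max y1 (t - e) < t by rewrite gt_max yt; lra.
  have [z] := avoid_seq [::] pos; rewrite gt_max => /andP[/andP[z1 z2] z3] _.
  by exists z; split; [apply: St; rewrite z1 | apply: eB; rewrite /ball/= ltr_norml; lra].
pose Z := [set t | y1 < t <= y /\ forall z, y1 < z < t -> S z].
have [yy2|yy2] := leP y y2.
  by apply: lim => [|z zy]; [lra | apply: S12; lra].
have Zs : has_sup Z.
  split; first by exists y2; split=> //; lra.
  by exists y => t [+ _]; lra.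
pose t := sup Z.
have t2 : y2 <= t by apply: ub_le_sup; [case: Zs|split=> //; lra].
have ty : t <= y by apply: sup_le_ub; [case: Zs|move=> r [+ _]; lra].
have St z : y1 < z < t -> S z.
  move=> /andP[z1 zt]; have [r [_ rS] zr] := sup_gt (proj1 Zs) zt.
  by apply: rS; rewrite z1.
have tS : S t by apply: lim => //; lra.
have [ty'|ty'] := ltP t y; last by have -> : y = t by lra.
exfalso; have tl : lside S t.
  by exists (t - y1) => [|e he]; [lra | apply: St; lra].
have [d d0 dS] : rside S t.
  apply: contrapT => nr; have := jS t ltac:(lra).
  by rewrite /jump asboolF// asboolT// sub0r => /eqP; rewrite oppr_eq0 oner_eq0.
pose r := Num.min y (t + d / 2).
have [ry rd] : r <= y /\ r <= t + d / 2 by rewrite /r !ge_min !lexx orbT.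
have tr : t < r by rewrite lt_min ty'; lra.
have : Z r.
  split=> [|z zr]; first by lra.
  have [zt|tz] := ltP z t; first by apply: St; lra.
  case: (ltgtP t z) tz => // [tz _|<-//].
  by rewrite (_ : z = t + (z - t)); [apply: dS; lra | lra].
by move=> /(ub_le_sup (proj2 Zs)); rewrite -/t; lra.
Qed.

Lemma fill (R : realType) (S : set R) (C D c d : R) : closed S ->
  (forall b, C < b < D -> jump S b = 0) -> C <= c -> c < d -> d <= D ->
  (forall z, c < z < d -> S z) -> forall y, C < y < D -> S y.
Proof.
move=> cS jS Cc cd dD Scd y yD.
have [cy|yc] := ltP c y.
  by apply: (fill_right cS jS Cc cd Scd); lra.
pose S' := [set z | S (- z)].
have cS' : closed S'.
  by apply: (closed_comp (f := -%R)) => // x _; exact: opp_continuous.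
suff : S' (- y) by rewrite /S'/= opprK.
apply: (@fill_right _ S' (- D) (- C) (- d) (- c)) => //; try lra.
  by move=> b hb; rewrite reflect_jump jS ?oppr0//; lra.
by move=> z hz; apply: Scd; lra.
Qed.

(** Each slice off the breaks is filled from []c, d[] to []C, D[]; the finitely many remaining
    abscissas follow since [A] is closed. *)
Lemma strip_fill (R : realType) (A : set (plane R)) V L (a b c d C D : R) :
  lined A V L -> C <= c -> c < d -> d <= D ->
  (forall x y : R, a < x < b -> c < y < d -> A (x, y)) ->
  (forall x y : R, x \notin breaks V L -> a < x < b -> C < y < D -> jump (slice A x) y = 0) ->
  forall x y : R, a < x < b -> C < y < D -> A (x, y).
Proof.
move=> [cA rA uL AL] Cc cd dD Abox jA x y xab yCD.
have clA : closed A by exact: compact_closed.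
have full x' : x' \notin breaks V L -> a < x' < b -> A (x', y).
  move=> xN xab'; apply: (@fill _ (slice A x') C D c d) => //.
  - exact: slice_closed.
  - by move=> z hz; apply: jA.
  - by move=> z hz; apply: Abox.
rewrite [A]((closure_id _).1 clA) => B /nbhs_plane[e e0 eB].
have pos : x < Num.min b (x + e) by rewrite lt_min; lra.
have [x' + x'N] := avoid_seq (breaks V L) pos; rewrite lt_min => hx'.
exists (x', y); split; first by apply: full => //; lra.
by apply: eB; rewrite /= ?subrr ?normr0// ltr_norml; lra.
Qed.

(** A jump at [(x, b)] lies on a line carrying boundary, hence supporting [A]. The segment from [u]
    to [v], translated so as to pass through [(x, b)], still ends in the two boxes; both ends are
    then strictly on one side of that line, and so is [(x, b)]. *)
Lemma box_nojump (R : realType) (A K : set (plane R)) V L (u v : plane R) (e s x b : R) :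
  lined A V L -> convex_body K -> covariogram A =1 covariogram K ->
  (forall x y : R, `|x - u.1| < e -> `|y - u.2| < e -> A (x, y)) ->
  (forall x y : R, `|x - v.1| < e -> `|y - v.2| < e -> A (x, y)) ->
  0 <= s <= 1 -> x \notin breaks V L ->
  `|x - (seg u v s).1| < e -> `|b - (seg u v s).2| < e -> jump (slice A x) b = 0.
Proof.
move=> Al hK gAK Au Av s01 xN hx hb.
apply: contrapT => /eqP jb.
have [_ /(_ x xN)[_ _ S]] := lined_sliced Al.
have /mapP[l lL bE] : b \in cuts L x.
  by apply: contraNT jb => bN; rewrite (jump0 S bN).
have jl : ljump A l x != 0 by rewrite /ljump -bE.
pose dx := x - (seg u v s).1; pose dy := b - (seg u v s).2.
have pos : 0 < e - `|dy| by rewrite subr_gt0.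
(* A vertical margin left inside the boxes, which makes the two inequalities strict. *)
have [f f1 _] := avoid_seq [::] pos.
have ux (w : plane R) : `|w.1 + dx - w.1 : R| < e by rewrite addrAC subrr add0r.
have uy (w : plane R) (g : R) : `|g| <= f -> `|w.2 + (dy + g) - w.2 : R| < e.
  move=> gf; rewrite addrAC subrr add0r; apply: le_lt_trans (ler_normD _ _) _; lra.
have fp : `|f| <= f by rewrite ger0_norm; lra.
have fn : `|- f| <= f by rewrite normrN ger0_norm; lra.
have E : (1 - s) * (u.2 + dy - l.1 * (u.1 + dx) - l.2) +
    s * (v.2 + dy - l.1 * (v.1 + dx) - l.2) = 0.
  have : b - l.1 * x - l.2 = 0 by rewrite bE /line; ring.
  move=> <-; rewrite [in RHS](_ : b = (seg u v s).2 + dy); last by rewrite /dy subrKC.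
  rewrite [in RHS](_ : x = (seg u v s).1 + dx); last by rewrite /dx subrKC.
  by rewrite /seg/=; ring.
have [sup|inf] := essential_supporting Al hK gAK lL xN jl.
- have h1 := sup _ _ (Au _ _ (ux u) (uy u f fp)).
  have h2 := sup _ _ (Av _ _ (ux v) (uy v f fp)).
  have := convex_gt0 s01 (p := - (u.2 + dy - l.1 * (u.1 + dx) - l.2))
    (q := - (v.2 + dy - l.1 * (v.1 + dx) - l.2)).
  by lra.
- have h1 := inf _ _ (Au _ _ (ux u) (uy u (- f) fn)).
  have h2 := inf _ _ (Av _ _ (ux v) (uy v (- f) fn)).
  have := convex_gt0 s01 (p := (u.2 + dy - l.1 * (u.1 + dx) - l.2))
    (q := (v.2 + dy - l.1 * (v.1 + dx) - l.2)).
  by lra.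
Qed.

(* (p, q, c) stands for the line p x + q y = c *)
Definition polylined (R : realType) (A : set (plane R)) (T : seq (R * R * R)) :=
  forall x y : R, A (x, y) -> ~ A° (x, y) -> exists t, [/\ t \in T,
    (t.1.1 != 0) || (t.1.2 != 0) & t.1.1 * x + t.1.2 * y = t.2].

(** [polylined] treats both coordinates alike and so passes to the transpose, whereas [lined]
    singles out vertical lines. *)
Lemma polylined_lined (R : realType) (A : set (plane R)) T :
  compact A -> regclosed A -> polylined A T -> exists V L, lined A V L.
Proof.
move=> cA rA AT.
exists [seq t.2 / t.1.1 | t <- T], (undup [seq (- t.1.1 / t.1.2, t.2 / t.1.2) | t <- T]).
split=> //; first exact: undup_uniq.
move=> x y Axy nA; have [t [tT tn tE]] := AT _ _ Axy nA.
have [q0|q0] := eqVneq t.1.2 0.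
  left; apply/mapP; exists t => //; move: tn; rewrite q0 eqxx orbF => p0.
  by rewrite -tE q0 mul0r addr0; field.
right; exists (- t.1.1 / t.1.2, t.2 / t.1.2).
  by rewrite mem_undup; apply/mapP; exists t.
by rewrite /line/= -tE; field.
Qed.

Lemma polylined_transpose (R : realType) (A : set (plane R)) T :
  polylined A T -> polylined (transpose A) [seq (t.1.2, t.1.1, t.2) | t <- T].
Proof.
move=> AT x y Axy; rewrite transpose_interior => nA.
have [t [tT tn tE]] := AT _ _ Axy nA.
exists (t.1.2, t.1.1, t.2); split => /=.
- by apply/mapP; exists t.
- by rewrite orbC.
- by rewrite addrC.
Qed.

Lemma classB_polylined (R : realType) (A : set (plane R)) :
  classB A -> exists T, polylined A T.
Proof.
move=> [cA rA [k [C [simpleC _ bdA]]]].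
have /choice[T TP] : forall i : 'I_k, exists T : seq (R * R * R), forall x y : R,
    C i (x, y) -> exists t, [/\ t \in T, (t.1.1 != 0) || (t.1.2 != 0) &
      t.1.1 * x + t.1.2 * y = t.2].
  move=> i; have [n [p [_ ->]]] := simpleC i.
  (* The line through an edge; for coinciding end points, the vertical line through the point. *)
  pose tr (j : 'I_n.+1) : R * R * R :=
    let P := p j in let Q := p (ordS j) in
    if P == Q then (1, 0, P.1 : R)
    else (Q.2 - P.2, P.1 - Q.1, (Q.2 - P.2) * P.1 + (P.1 - Q.1) * P.2).
  exists [seq tr j | j <- enum 'I_n.+1] => x y [[j t] _].
  rewrite /polygonal_path/= => -[xE yE]; exists (tr j); split.
  - by apply: map_f; rewrite mem_enum.
  - rewrite /tr; have [_|/eqP PQ] := eqVneq (p j) (p (ordS j)); first by rewrite /= oner_eq0.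
    rewrite /=.
    rewrite -negb_and !subr_eq0; apply/negP => /andP[/eqP e2 /eqP e1]; apply: PQ.
    by rewrite [p j]surjective_pairing e1 -e2 -surjective_pairing.
  - rewrite -xE -yE /tr; have [<-|_] := eqVneq (p j) (p (ordS j)); rewrite /= /GRing.scale/=; ring.
exists (flatten [seq T i | i <- enum 'I_k]) => x y Axy nA.
have : boundary A (x, y) by split=> //; exact: subset_closure.
rewrite bdA => -[i _ /TP[t [tT tn tE]]]; exists t; split=> //.
by apply/flattenP; exists (T i) => //; apply: map_f; rewrite mem_enum.
Qed.

(** Jumps vanish in the box of radius [e] around the point, along slices in both directions.
    Regularity puts a small box of [A] inside it, which is then spread over the whole box. *)
Lemma box_fill (R : realType) (A K : set (plane R)) T (u v : plane R) (e s : R) :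
  compact A -> regclosed A -> polylined A T -> convex_body K ->
  covariogram A =1 covariogram K ->
  (forall x y : R, `|x - u.1| < e -> `|y - u.2| < e -> A (x, y)) ->
  (forall x y : R, `|x - v.1| < e -> `|y - v.2| < e -> A (x, y)) ->
  0 < e -> 0 <= s <= 1 -> A (seg u v s) -> A° (seg u v s).
Proof.
move=> cA rA AT hK gAK Au Av e0 s01 As; have [_ cK _] := hK.
have [V [L Al]] := polylined_lined cA rA AT.
have [V' [L' Al']] := polylined_lined (transpose_compact cA) (transpose_regclosed rA)
  (polylined_transpose AT).
have gAK' : covariogram (transpose A) =1 covariogram (transpose K).
  by move=> z; rewrite !covariogram_transpose// gAK.
set w := seg u v s in As *.
pose a : R := w.1; pose b : R := w.2.
have box0 : nbhs w [set z : plane R | `|(z.1 : R) - a| < e /\ `|(z.2 : R) - b| < e].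
  by apply/nbhs_plane; exists e.
have [[x0 y0] [/nbhs_plane[d d0 dA] [/= z1 z2]]] : A° `&`
    [set z : plane R | `|(z.1 : R) - a| < e /\ `|(z.2 : R) - b| < e] !=set0.
  have : closure A° w by rewrite rA.
  by apply.
pose r1 := Num.min d (e - `|(x0 : R) - a|).
pose r2 := Num.min d (e - `|(y0 : R) - b|).
have [r10 r1d r1e] : [/\ 0 < r1, r1 <= d & r1 <= e - `|(x0 : R) - a|].
  by rewrite /r1 lt_min !ge_min !lexx orbT d0 subr_gt0 z1.
have [r20 r2d r2e] : [/\ 0 < r2, r2 <= d & r2 <= e - `|(y0 : R) - b|].
  by rewrite /r2 lt_min !ge_min !lexx orbT d0 subr_gt0 z2.
have b1 : - `|(x0 : R) - a| <= (x0 : R) - a <= `|(x0 : R) - a| by rewrite -ler_norml.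
have b2 : - `|(y0 : R) - b| <= (y0 : R) - b <= `|(y0 : R) - b| by rewrite -ler_norml.
(* The small box is extended to the full height of the large one. *)
have strip1 (x y : R) : (x0 : R) - r1 < x < x0 + r1 -> b - e < y < b + e -> A (x, y).
  apply: (@strip_fill _ A V L ((x0 : R) - r1) (x0 + r1) ((y0 : R) - r2) (y0 + r2)) => //;
    [lra|lra|lra|..].
  - by move=> x' y' hx hy; apply: dA; rewrite /= ltr_norml; lra.
  - move=> x' y' xN hx hy; apply: (box_nojump Al hK gAK Au Av s01 xN).
      by rewrite -/w -/a ltr_norml; lra.
    by rewrite -/w -/b ltr_norml; lra.
(* The strip so obtained is extended to the full width, as a vertical filling of the transposed
   set. *)
have strip2 (y x : R) : b - e < y < b + e -> a - e < x < a + e -> transpose A (y, x).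
  apply: (@strip_fill _ (transpose A) V' L' (b - e) (b + e) ((x0 : R) - r1) (x0 + r1)) => //;
    [lra|lra|lra|..].
  - by move=> y' x' hy hx; apply: strip1.
  - move=> y' x' yN hy hx.
    apply: (@box_nojump _ (transpose A) (transpose K) V' L' (u.2, u.1) (v.2, v.1) e s) => //.
    + exact: transpose_body.
    + by move=> p q h h'; exact: Au.
    + by move=> p q h h'; exact: Av.
    + by move: hy; rewrite /b /w /seg/= ltr_norml; lra.
    + by move: hx; rewrite /a /w /seg/= ltr_norml; lra.
apply/nbhs_plane; exists e => // x y; rewrite -/a -/b !ltr_norml => hx hy.
by apply: strip2; lra.
Qed.

(** For interior end points [box_fill] excludes boundary points on the segment, so [segment_nobd]
    applies. Arbitrary end points are limits of interior ones, and [A] is closed. *)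
Lemma polylined_convex (R : realType) (A K : set (plane R)) T :
  compact A -> regclosed A -> polylined A T -> convex_body K ->
  covariogram A =1 covariogram K -> convex_set A.
Proof.
move=> cA rA AT hK gAK; have clA : closed A by exact: compact_closed.
have inner u v (s : R) : A° u -> A° v -> 0 <= s <= 1 -> A (seg u v s).
  move=> Au Av s01.
  have [/nbhs_plane[e1 e10 eu] /nbhs_plane[e2 e20 ev]] := (Au, Av).
  pose e := Num.min e1 e2; have e0 : 0 < e by rewrite lt_min e10.
  have [ee1 ee2] : e <= e1 /\ e <= e2 by rewrite /e !ge_min !lexx orbT.
  apply: (@segment_nobd _ A u) => //; last exact: interior_subset.
  (* The segment from [u] to [seg u v s] is an initial part of the one from [u] to [v]. *)
  move=> r r01; have -> : seg u (seg u v s) r = seg u v (r * s).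
    by apply/pair_equal_spec; rewrite /seg/=; split; ring.
  apply: (box_fill cA rA AT hK gAK _ _ e0).
  - by move=> x y hx hy; apply: eu; lra.
  - by move=> x y hx hy; apply: ev; lra.
  - by apply/andP; split; nra.
apply/convex_setP => u v s Au Av s01.
rewrite [A]((closure_id _).1 clA) => B /nbhs_plane[e e0 eB].
have near w : A w -> exists2 w', A° w' & `|w'.1 - w.1 : R| < e /\ `|w'.2 - w.2 : R| < e.
  rewrite -[in X in X -> _]rA => /(_ (ball w e)) []; first exact: nbhsx_ballx.
  move=> w' [Aw' [h1 h2]]; exists w' => //.
  by move: h1 h2; rewrite /ball/= ![`|w.1 - _|]distrC ![`|w.2 - _|]distrC.
have [u' Au' [u1 u2]] := near _ Au; have [v' Av' [v1 v2]] := near _ Av.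
exists (seg u' v' s); split; first exact: inner.
have cv (p p' q q' : R) : `|p' - p| < e -> `|q' - q| < e ->
    `|p' + s * (q' - p') - (p + s * (q - p))| < e.
  rewrite !ltr_norml => hp hq.
  have h1 := convex_gt0 s01 (p := e - (p' - p)) (q := e - (q' - q)).
  have h2 := convex_gt0 s01 (p := e + (p' - p)) (q := e + (q' - q)).
  by lra.
by apply: eB; apply: cv.
Qed.

Theorem theorem1p3 (R : realType) (A K : set (plane R)) (hA : classB A)
  (hK : convex_body K) (hg : covariogram A = covariogram K) :
  convex_set A.
Proof.
have [T AT] := classB_polylined hA; have [cA rA _] := hA.
by apply: (polylined_convex cA rA AT hK) => z; rewrite hg.
Qed.
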